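(* Let $\lambda>0$. For any fixed $t\ge 0$, $$\left|\frac{\mathcal{C}(t,n,\lambda)}{n}-\alpha(t,\lambda )\right|=O(n^{-1}), \quad \text{ as } n\rightarrow\infty .$$
   Context: Discrete sequential packing. Fix $m\in\mathbb{N}_+$ and a probability distribution supported on $\{1,\dots,m\}$ (the bundle size distribution; $m$ is the maximum bundle size), with mass function $f(k)=P(B=k)$ and distribution function $F(k)=P(B\le k)$. Line model: there are $n$ packages at locations $1,\dots,n$ on a line, all available at time $0$. To each location $i$ is attached a Poisson process of rate $\lambda>0$; the processes at different locations are independent, and each point of each process carries a mark (bundle size); all marks are i.i.d. with distribution $F$ and independent of all the Poisson processes. A point of the process at location $i$ with mark $k$ is a request for the packages at locations $i,i+1,\dots,i+k-1$. The request is accepted if $i+k-1\le n$ and all these packages are still available at that time, in which case all $k$ of them are picked up (removed permanently); otherwise it is rejected and nothing changes. $\mathcal{K}(t,n,\lambda)$ denotes the expected number of packages picked up during $[0,t]$. Circle model: the same, except that the $n$ locations are arranged on a circle (locations are taken modulo $n$), and a request of size $k$ at $i$ is accepted if $k\le n$ and the packages at $i,i+1,\dots,i+k-1$ (modulo $n$) are all available. $\mathcal{C}(t,n,\lambda)$ denotes the expected number of packages picked up during $[0,t]$ in the circle model. $\alpha(t,\lambda):=\lim_{n\to\infty}\mathcal{K}(t,n,\lambda)/n$ (this limit exists). $f(x)=O(g(x))$ as $x\to\infty$ means $\limsup_{x\to\infty}|f(x)/g(x)|<\infty$. *)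

(* Defs.v *)
From HB Require Import structures.
From mathcomp Require Import all_boot all_order all_algebra finmap.
From mathcomp Require Import all_classical all_reals all_analysis.

Set Implicit Arguments.
Unset Strict Implicit.
Unset Printing Implicit Defensive.

Import Order.TTheory GRing.Theory Num.Theory.
Import numFieldNormedType.Exports.

Local Open Scope classical_set_scope.
Local Open Scope ring_scope.

Definition mutually_independent d (T : measurableType d) (R : realType)
    (P : probability T R) (I : choiceType) (G : I -> set (set T)) : Prop :=
  forall (J : {fset I}) (A : I -> set T),
    (forall i, i \in J -> G i (A i)) ->
    P (\bigcap_(i in [set` J]) A i) = (\prod_(i <- J) P (A i))%E.

Definition generated_sigma_algebra d d' (T : measurableType d)
    (T' : measurableType d') (X : T -> T') : set (set T) :=
  preimage_set_system setT X measurable.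

(* A realization, on some probability space, of n independent Poisson processes
   of rate lam, one per location, with i.i.d. marks of law F.  Locations are
   numbered from 0.  The points of a Poisson process are the partial sums of
   i.i.d. exponential gaps: gap i j is the time between the j-th and the
   (j+1)-th point at location i (time 0 being the 0-th point), and mark i j is
   the mark of the latter. *)
Record marked_poisson (R : realType) (lam : R) (F : probability nat R)
    (n : nat) := MarkedPoisson {
  mp_display : measure_display;
  mp_space : measurableType mp_display;
  mp_prob : probability mp_space R;
  gap : 'I_n -> nat -> {RV mp_prob >-> R};
  mark : 'I_n -> nat -> {RV mp_prob >-> nat};
  gap_law : forall i j (A : set R), measurable A ->
    distribution mp_prob (gap i j) A = exponential_prob lam A;
  mark_law : forall i j (A : set nat), measurable A ->
    distribution mp_prob (mark i j) A = F A;
  gap_mark_independent : mutually_independent mp_prob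
    (fun r : ('I_n * nat) + ('I_n * nat) =>
       match r with
       | inl ij => generated_sigma_algebra (gap ij.1 ij.2)
       | inr ij => generated_sigma_algebra (mark ij.1 ij.2)
       end) }.

(* What a request of size k at location i asks for, or None if a request of
   that size is rejected irrespective of availability. *)
Definition line_request n (i : 'I_n) (k : nat) : option {set 'I_n} :=
  if (i + k <= n)%N
  then Some [set x : 'I_n | [exists l : 'I_k, x == (i + l)%N :> nat]]%SET
  else None.

Definition circle_request n (i : 'I_n) (k : nat) : option {set 'I_n} :=
  if (k <= n)%N
  then Some [set x : 'I_n | [exists l : 'I_k, x == ((i + l) %% n)%N :> nat]]%SET
  else None.

(* The set of packages picked up so far, after one more request. *)
Definition serve n (picked : {set 'I_n}) (req : option {set 'I_n}) :
    {set 'I_n} :=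
  if req is Some B then
    if [disjoint B & picked] then (picked :|: B)%SET else picked
  else picked.

Section pickup.
Context (R : realType) (lam : R) (F : probability nat R) (n : nat).
Context (M : marked_poisson lam F n).

Definition arrival (w : mp_space M) (r : 'I_n * nat) : R :=
  \sum_(l < r.2.+1) gap M r.1 l w.

(* The requests during [0, t], in chronological order.  Almost surely, all
   arrival times are positive and distinct and there are finitely many of them
   before t; fset_set yields the empty set when there are infinitely many. *)
Definition requests (t : R) (w : mp_space M) : seq ('I_n * nat) :=
  sort (fun r r' => arrival w r <= arrival w r')
       (fset_set [set r | arrival w r <= t]).

Definition picked_up (request : 'I_n -> nat -> option {set 'I_n}) (t : R)
    (w : mp_space M) : {set 'I_n} :=
  foldl (fun A r => serve A (request r.1 (mark M r.1 r.2 w)))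
        finset.set0 (requests t w).

Definition mean_picked_up (request : 'I_n -> nat -> option {set 'I_n}) (t : R)
    : R :=
  fine 'E_(mp_prob M)[fun w => #|picked_up request t w|%:R].

Definition mean_line (t : R) : R := mean_picked_up (@line_request n) t.
Definition mean_circle (t : R) : R := mean_picked_up (@circle_request n) t.

End pickup.

Definition alpha (R : realType) (lam : R) (F : probability nat R)
    (M : forall n, marked_poisson lam F n) (t : R) : R :=
  lim (mean_line (M n) t / n%:R @[n --> \oo]).

(* Main.v *)
Require Import Defs.
From HB Require Import structures.
From mathcomp Require Import all_boot all_order all_algebra finmap.
From mathcomp Require Import all_classical all_reals all_analysis.
From mathcomp Require Import measurable_realfun.
From mathcomp Require Import zify ring lra.

(** Write [K n] for the expected number of packages picked up before time [t] on
    the line with [n] locations, and [C n] for the same number on the circle.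
    Everything rests on a decoupling property. Call a location idle if its first
    request comes after time [t]; this happens with probability
    [expR (- lam * t)], independently for all locations. A request asks for at
    most [m] consecutive packages, all of them at or after its location. Hence a
    request addressed to the left of [m] consecutive idle locations cannot reach
    beyond them, and none is addressed to the idle locations themselves: what
    happens on one side of an idle block does not depend on the other side.

    Cutting the line at one place, that is, rejecting the requests that straddle
    the cut, therefore only changes the outcome between the nearest idle block on
    the left and the nearest one on the right ([serve_line_cut]), and the line is
    obtained from the circle by such a cut ([serve_circle_line]). The rank of the
    nearest idle block is dominated by a geometric variable
    ([expected_idle_run]), so that the expected length of the affected zone has
    a bound [c] that does not depend on [n] ([expected_affected_zone]).

    Applied to the circle this gives [`|C n - K n| <= c]. Applied to a cut of the
    line with [a + b] locations, whose two halves are independent copies of the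
    lines with [a] and [b] locations, it gives
    [`|K (a + b) - (K a + K b)| <= c] ([mean_line_almost_additive]). An almost
    additive sequence satisfies [`|K n / n - alpha| <= c / n]
    ([almost_additive_rate]), and the two bounds add up.

    Two points come from the probabilistic model. The realizations for different
    [n] live on unrelated probability spaces, so one needs that the mean is
    determined by the laws of the gaps and marks ([mean_picked_up_unique]); this
    requires the measurability of the outcome and the pi-lambda theorem. Also,
    the chronological order of the requests is well defined, and compatible with
    the passage to a half of the line, only if no two requests are simultaneous
    and finitely many come before [t]; both hold almost surely ([ae_good]). *)

Set Implicit Arguments.
Unset Strict Implicit.
Unset Printing Implicit Defensive.

Import Order.TTheory GRing.Theory Num.Theory.
Import numFieldNormedType.Exports.

Local Open Scope ring_scope.

(** * Serving a list of requests *)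

Section serving.
Variable n : nat.
Implicit Types (A D : {set 'I_n}) (request : 'I_n -> nat -> option {set 'I_n}).
Implicit Types (s : seq ('I_n * nat)) (o : option {set 'I_n}).

Definition serve_all request s : {set 'I_n} :=
  foldl (fun A r => serve A (request r.1 r.2)) finset.set0 s.

Definition block o : {set 'I_n} := odflt finset.set0 o.

Lemma serve_setD_sub A o D : block o \subset D ->
  (serve A o :\: D = A :\: D)%SET.
Proof.
case: o => //= B BD; case: ifP => // _.
by rewrite finset.setDUl (_ : B :\: D = finset.set0)%SET ?finset.setU0//;
  apply/eqP; rewrite finset.setD_eq0.
Qed.

Lemma serve_setD_disjoint A1 A2 o D : [disjoint block o & D] ->
  (A1 :\: D = A2 :\: D -> serve A1 o :\: D = serve A2 o :\: D)%SET.
Proof.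
case: o => //= B BD A12.
have dis A : [disjoint B & A] = [disjoint B & A :\: D]%SET.
  rewrite -!setI_eq0; congr (_ == _); apply/setP => x; rewrite !inE.
  by case xB: (x \in B); rewrite ?andbF//= (disjointFr BD xB).
rewrite (dis A1) (dis A2) A12; case: ifP => // _.
by rewrite !finset.setDUl A12.
Qed.

(** The locations outside [D] see the same requests in both systems, and no
    request makes them depend on what happens in [D]. *)
Lemma serve_all_eq_outside request1 request2 D s :
    (forall i k, (i, k) \in s ->
      (block (request1 i k) \subset D /\ block (request2 i k) \subset D) \/
      (request1 i k = request2 i k /\ [disjoint block (request1 i k) & D])) ->
  (serve_all request1 s :\: D = serve_all request2 s :\: D)%SET.
Proof.
rewrite /serve_all => sD.
suff base : forall A1 A2 : {set 'I_n}, (A1 :\: D = A2 :\: D)%SET ->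
    (foldl (fun A r => serve A (request1 r.1 r.2)) A1 s :\: D =
     foldl (fun A r => serve A (request2 r.1 r.2)) A2 s :\: D)%SET by exact: base.
elim: s sD => [//|[i k] s IH] sD A1 A2 A12 /=.
apply: IH => [j l jl|]; first by apply: sD; rewrite inE jl orbT.
have [[sub1 sub2]|[<- dis]] := sD i k (mem_head _ _).
  by rewrite !serve_setD_sub.
exact: serve_setD_disjoint.
Qed.

(** Applied in both directions, this turns agreement outside [D] into a bound on
    the difference of the numbers of packages. *)
Lemma card_le_outside (A1 A2 D : {set 'I_n}) :
  (A1 :\: D = A2 :\: D)%SET -> (#|A1| <= #|A2| + #|D|)%N.
Proof.
move=> A12; rewrite -(cardsID D A1) A12 addnC leq_add//.
  exact: subset_leq_card (finset.subsetDl _ _).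
exact: subset_leq_card (finset.subsetIr _ _).
Qed.

Lemma card_interval_le (a b : nat) :
  (#|[set x : 'I_n | (a <= x < b)%N]%SET| <= b - a)%N.
Proof.
rewrite cardE -(size_map val) -(size_iota a (b - a)).
apply: uniq_leq_size; first by rewrite map_inj_uniq ?enum_uniq//; exact: val_inj.
move=> _ /mapP[x + ->]; rewrite mem_enum inE mem_iota => /andP[ax xb] /=.
by rewrite ax/=; lia.
Qed.

End serving.

Section embedding.
Variables (a n : nat) (f : 'I_a -> 'I_n).
Hypothesis f_inj : injective f.

(** A sub-line of the locations is described by an injection [f]; the requests
    addressed elsewhere disappear. *)
Definition pull (T : Type) (s : seq ('I_n * T)) : seq ('I_a * T) :=
  pmap (fun r => omap (fun i => (i, r.2)) [pick i | f i == r.1]) s.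

Lemma pickE i : [pick j | f j == f i] = Some i.
Proof. by case: pickP => [j /eqP/f_inj->//|/(_ i)]; rewrite eqxx. Qed.

Lemma pickN x : x \notin codom f -> [pick j | f j == x] = None.
Proof. by case: pickP => // j /eqP <-; rewrite codom_f. Qed.

(** If no request addressed outside the sub-line touches it, then the sub-line
    evolves as a system of its own. *)
Lemma serve_all_pull (request : 'I_n -> nat -> option {set 'I_n})
    (request' : 'I_a -> nat -> option {set 'I_a}) s :
    (forall i k, request (f i) k = omap (fun B : {set 'I_a} => f @: B)%SET (request' i k)) ->
    (forall x k, x \notin codom f -> [disjoint block (request x k) & codom f]) ->
  serve_all request' (pull s) = (f @^-1: serve_all request s)%SET.
Proof.
move=> reqf reqN; rewrite /serve_all.
suff base : forall (A : {set 'I_n}) A', A' = (f @^-1: A)%SET ->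
  foldl (fun A r => serve A (request' r.1 r.2)) A' (pull s) =
  (f @^-1: foldl (fun A r => serve A (request r.1 r.2)) A s)%SET.
  by apply: base; rewrite preimset0.
elim: s => [//|[x k] s IH] A A' A'A /=.
have [/codomP[i ->]|xN] := boolP (x \in codom f).
  rewrite pickE /=; apply: IH; rewrite reqf.
  case: (request' i k) => //= B; rewrite A'A.
  have -> : [disjoint f @: B & A]%SET = [disjoint B & f @^-1: A]%SET.
    apply/pred0P/pred0P => [dis y /=|dis y /=]; apply/negP => /andP[].
      move=> yB; rewrite inE => yA; have /negP[] := negbT (dis (f y)).
      by rewrite /= yA andbT; apply/imsetP; exists y.
    move=> /imsetP[z zB ->] zA; have /negP[] := negbT (dis z).
    by rewrite /= zB inE.
  case: ifP => // _; apply/setP => y; rewrite !inE; congr orb.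
  apply/idP/imsetP => [yB|[z zB /f_inj->//]]; by exists y.
rewrite pickN//=; apply: IH; rewrite A'A.
case: (request x k) (reqN x k xN) => //= B dis; case: ifP => // _.
apply/setP => y; rewrite !inE; case yB : (f y \in B); rewrite ?orbF//.
by have := disjointFr dis yB; rewrite codom_f.
Qed.

End embedding.

(** * Effect of a cut, and idle blocks *)

Section geometry.
Variables (n m : nat).
Implicit Types (i x : 'I_n) (k : nat) (Z : {set 'I_n}).

Lemma in_block_line i k x :
  (x \in block (line_request i k)) = (i + k <= n)%N && (i <= x < i + k)%N.
Proof.
rewrite /line_request; case: ifP => ikn /=; last by rewrite inE.
rewrite inE; apply/existsP/idP => [[l /eqP ->]|/andP[ix xk]].
  by have := ltn_ord l; lia.
have xik : (x - i < k)%N by lia.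
by exists (Ordinal xik); apply/eqP => /=; lia.
Qed.

Lemma in_block_circle i k x : (x \in block (circle_request i k)) =
  (k <= n)%N && ((i <= x < i + k)%N || (i <= x + n < i + k)%N).
Proof.
have [xn iin] := (ltn_ord x, ltn_ord i).
rewrite /circle_request; case: ifP => kn /=; last by rewrite inE.
rewrite inE; apply/existsP/idP => [[l /eqP xl]|ik].
  have lk := ltn_ord l; have [iln|iln] := ltnP (i + l) n.
    by move: xl; rewrite modn_small//; lia.
  by move: xl; rewrite -(subnK iln) modnDr modn_small; lia.
have [/andP[ix xk]|] := boolP (i <= x < i + k)%N.
  have xik : (x - i < k)%N by lia.
  by exists (Ordinal xik); apply/eqP => /=; rewrite subnKC// modn_small.
move=> /negPf h; move: ik; rewrite h /= => /andP[ix xk].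
have xik : (x + n - i < k)%N by lia.
by exists (Ordinal xik); apply/eqP => /=; rewrite subnKC// modnDr modn_small.
Qed.

Lemma circle_request_line i k : (0 < k)%N -> (i + k <= n)%N ->
  circle_request i k = line_request i k.
Proof.
move=> k0 ikn; rewrite /circle_request /line_request ikn ifT; last by lia.
congr Some; apply/setP => x; rewrite !inE; apply: eq_existsb => l.
by rewrite modn_small//; have := ltn_ord l; lia.
Qed.

(** No request of size at most [m] crosses the border between [c - 1] and [c]:
    the requests to its right extend to the right, and those to its left are too
    far away. *)
Definition sealed (s : seq ('I_n * nat)) (c : nat) :=
  forall i k, (i, k) \in s -> (i < c)%N -> (i + m <= c)%N.

Definition sizes_in_range (s : seq ('I_n * nat)) :=
  forall i k, (i, k) \in s -> (0 < k <= m)%N.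

(** The line cut into the two independent lines [0 .. c - 1] and [c .. n - 1]. *)
Definition cut_request (c : nat) i k : option {set 'I_n} :=
  if (i < c < i + k)%N then None else line_request i k.

(** The two systems differ only for the requests that straddle [c]; these lie
    between the sealed borders [L] and [R]. The ends of the line count as sealed,
    because requests that leave the line are rejected. *)
Lemma line_cut_outside s (c L R : nat) : sizes_in_range s ->
    (L <= c <= R)%N -> (L = 0%N \/ sealed s L) -> (R = n \/ sealed s R) ->
  let D := [set x : 'I_n | (L <= x < R)%N]%SET in
  (serve_all (@line_request n) s :\: D = serve_all (cut_request c) s :\: D)%SET.
Proof.
move=> sm /andP[Lc cR] sL sR D; apply: serve_all_eq_outside => i k iks.
have /andP[k0 km] := sm _ _ iks; have iN := ltn_ord i.
have iL : (i < L)%N -> (i + m <= L)%N.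
  by case: sL => [->//|/(_ _ _ iks)].
have iR : (i < R)%N -> R = n \/ (i + m <= R)%N.
  by case: sR => [->|/(_ _ _ iks)]; auto.
have blockcut x : x \in block (cut_request c i k) ->
    x \in block (line_request i k).
  by rewrite /cut_request; case: ifP => //; rewrite inE.
have [iltL|Lei] := ltnP i L; last have [iltR|Rlei] := ltnP i R.
- right; rewrite /cut_request ifF; last by lia.
  split => //; apply/pred0P => x /=; apply/negP => /andP[].
  by rewrite in_block_line inE; move: (iL iltL); lia.
- left; suff sub : block (line_request i k) \subset D.
    by split => //; apply: fintype.subset_trans sub; apply/fintype.subsetP.
  apply/fintype.subsetP => x; rewrite in_block_line inE.
  by move: (ltn_ord x); case: (iR iltR); lia.
- right; rewrite /cut_request ifF; last by lia.
  split => //; apply/pred0P => x /=; apply/negP => /andP[].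
  by rewrite in_block_line inE; lia.
Qed.

(** Here the cut is between [n - 1] and [0], and the zone around it consists of the
    last and the first locations. The condition [m <= R] keeps the part of a
    request that goes around inside the zone. *)
Lemma circle_line_outside s (L R : nat) : sizes_in_range s ->
    (m <= R <= L)%N -> (L <= n)%N -> sealed s L -> sealed s R ->
  let D := [set x : 'I_n | (x < R)%N || (L <= x)%N]%SET in
  (serve_all (@circle_request n) s :\: D = serve_all (@line_request n) s :\: D)%SET.
Proof.
move=> sm /andP[mR RL] Ln sL sR D; apply: serve_all_eq_outside => i k iks.
have /andP[k0 km] := sm _ _ iks; have iN := ltn_ord i.
have iL := sL _ _ iks; have iR := sR _ _ iks.
have [[Ri iltL]|out] : (R <= i /\ i < L)%N \/ ((i < R)%N \/ (L <= i)%N) by lia.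
  right; rewrite circle_request_line//; last by have := iL iltL; lia.
  split => //; apply/pred0P => x /=; apply/negP => /andP[].
  by rewrite in_block_line inE; have := iL iltL; lia.
left; split; apply/fintype.subsetP => x; rewrite ?in_block_line ?in_block_circle inE;
  have := ltn_ord x; lia.
Qed.

Definition slab (c : nat) : {set 'I_n} := [set x : 'I_n | (c <= x < c + m)%N]%SET.
(** The [K] blocks are disjoint and counted away from [c], so that a small value
    means that a border near [c] is sealed when [Z] consists of locations without
    requests. The value [K] means that none of the blocks lies in [Z]. *)
Definition run_right (c K : nat) (Z : {set 'I_n}) : nat :=
  find (fun j => slab (c + j * m) \subset Z) (iota 0 K).
Definition run_left (c K : nat) (Z : {set 'I_n}) : nat :=
  find (fun j => slab (c - j.+1 * m) \subset Z) (iota 0 K).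

Lemma slab_sealed s Z (c : nat) : (forall i k, (i, k) \in s -> i \notin Z) ->
  slab c \subset Z -> sealed s (c + m).
Proof.
move=> sZ cZ i k iks ic; rewrite leqNgt; apply/negP => ci.
have /negP[] := sZ _ _ iks; apply: (fintype.subsetP cZ).
by rewrite inE; lia.
Qed.

Lemma find_iotaP (p : pred nat) K :
  (find p (iota 0 K) < K)%N /\ p (find p (iota 0 K)) \/ find p (iota 0 K) = K.
Proof.
have [hs|] := boolP (has p (iota 0 K)).
  have lt : (find p (iota 0 K) < K)%N by move: hs; rewrite has_find size_iota.
  by left; split => //; have := nth_find 0%N hs; rewrite nth_iota.
by move=> /hasNfind ->; rewrite size_iota; right.
Qed.

Lemma run_rightP s Z c K : (forall i k, (i, k) \in s -> i \notin Z) ->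
  sealed s (c + (run_right c K Z).+1 * m) /\ (run_right c K Z < K)%N \/
  run_right c K Z = K.
Proof.
move=> sZ; have [[lt sub]|] := find_iotaP (fun j => slab (c + j * m) \subset Z) K.
  left; split => //; have := slab_sealed sZ sub.
  by rewrite mulSn addnCA addnA addnC addnA.
by right.
Qed.

Lemma run_leftP s Z c K : (forall i k, (i, k) \in s -> i \notin Z) ->
  (K * m <= c)%N ->
  sealed s (c - run_left c K Z * m) /\ (run_left c K Z < K)%N \/
  run_left c K Z = K.
Proof.
move=> sZ Kc.
have [[lt sub]|] := find_iotaP (fun j => slab (c - j.+1 * m) \subset Z) K; last by right.
left; split => //; have := slab_sealed sZ sub; rewrite -/(run_left c K Z) in lt *.
have : ((run_left c K Z).+1 * m <= K * m)%N by rewrite leq_mul2r lt orbT.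
by rewrite mulSn => le; congr sealed; lia.
Qed.

Lemma serve_line_cut (s : seq ('I_n * nat)) Z (c : nat) : (0 < m)%N -> (c <= n)%N ->
    sizes_in_range s -> (forall i k, (i, k) \in s -> i \notin Z) ->
  let d := (m * ((run_left c (c %/ m) Z).+1 +
                 (run_right c ((n - c) %/ m) Z).+1))%N in
  let X := #|serve_all (@line_request n) s| in
  let Y := #|serve_all (cut_request c) s| in
  (X <= Y + d)%N /\ (Y <= X + d)%N.
Proof.
move=> m0 cn sm sZ d X Y.
suff [D [D1 D2]] : exists D : {set 'I_n},
    (serve_all (@line_request n) s :\: D = serve_all (cut_request c) s :\: D)%SET /\
    (#|D| <= d)%N.
  by split; [move: (card_le_outside D1) | move: (card_le_outside (esym D1))]; lia.
pose l := run_left c (c %/ m) Z; pose r := run_right c ((n - c) %/ m) Z.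
(* without an idle block on the left, the zone extends to the end of the line,
   which is less than one block beyond the last one examined *)
have [L [Lc sL Ld]] : exists L, [/\ (L <= c)%N, L = 0%N \/ sealed s L &
    (c - L <= m * l.+1)%N].
  have [[sl _]|lK] := run_leftP sZ (leq_trunc_div c m).
    exists (c - l * m)%N; split; [lia|by right|rewrite mulnS mulnC; lia].
  exists 0%N; split => //; first by left.
  by rewrite subn0 /l lK mulnC ltnW// ltn_ceil.
have [R [cR sR Rd]] : exists R, [/\ (c <= R)%N, R = n \/ sealed s R &
    (R - c <= m * r.+1)%N].
  have [[sr _]|rK] := run_rightP c ((n - c) %/ m) sZ.
    exists (c + r.+1 * m)%N; split; [lia|by right|rewrite mulnC; lia].
  exists n; split => //; first by left.
  by rewrite /r rK mulnC ltnW// ltn_ceil.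
exists [set x : 'I_n | (L <= x < R)%N]%SET; split.
  by apply: line_cut_outside => //; rewrite Lc.
apply: leq_trans (card_interval_le _ _ _) _; rewrite /d mulnDr.
by rewrite -/l -/r; lia.
Qed.

Lemma serve_circle_line (s : seq ('I_n * nat)) Z : (0 < m)%N ->
    sizes_in_range s -> (forall i k, (i, k) \in s -> i \notin Z) ->
  let d := (m * ((run_left n (n %/ m) Z).+1 + (run_right 0 (n %/ m) Z).+1))%N in
  let X := #|serve_all (@circle_request n) s| in
  let Y := #|serve_all (@line_request n) s| in
  (X <= Y + d)%N /\ (Y <= X + d)%N.
Proof.
move=> m0 sm sZ d X Y.
pose l := run_left n (n %/ m) Z; pose r := run_right 0 (n %/ m) Z.
have nceil : (n <= m * (n %/ m).+1)%N by rewrite mulnC ltnW// ltn_ceil.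
(* if [d] is smaller than [n], there are idle blocks on both sides and the two
   sealed borders do not overlap *)
have [nd|dn] := leqP n d.
  have le_n (A : {set 'I_n}) : (#|A| <= n)%N by rewrite -[leqRHS]card_ord max_card.
  by split; [move: (le_n (serve_all (@circle_request n) s)) |
             move: (le_n (serve_all (@line_request n) s))]; lia.
have dE : d = (m * l.+1 + m * r.+1)%N by rewrite -mulnDr.
have [[sl ll]|lK] := run_leftP sZ (leq_trunc_div n m); last first.
  by move: dn; rewrite dE /l lK; lia.
have [[sr _]|rK] := run_rightP 0 (n %/ m) sZ; last first.
  by move: dn; rewrite dE /r rK; lia.
rewrite -/l in sl ll; rewrite -/r add0n in sr.
pose D := [set x : 'I_n | (x < r.+1 * m)%N || (n - l * m <= x)%N]%SET.
have Dd : (#|D| <= d)%N.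
  have -> : D = ([set x : 'I_n | (0 <= x < r.+1 * m)%N] :|:
                 [set x : 'I_n | (n - l * m <= x < n)%N])%SET.
    by apply/setP => x; rewrite !inE/= ltn_ord andbT.
  rewrite cardsU; have := card_interval_le n 0 (r.+1 * m).
  have := card_interval_le n (n - l * m) n.
  by rewrite dE !mulnS (mulnC m); lia.
have D1 : (serve_all (@circle_request n) s :\: D =
           serve_all (@line_request n) s :\: D)%SET.
  apply: circle_line_outside => //; last by lia.
  by move: dn; rewrite dE !mulnS (mulnC m l) (mulnC m r) mulSn; lia.
by split; [move: (card_le_outside D1) Dd | move: (card_le_outside (esym D1)) Dd];
  rewrite -/X -/Y => le1 le2; apply: leq_trans le1 _; rewrite leq_add2l.
Qed.

End geometry.

(** ** The two halves of a cut line *)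

Section cut_line.
Variables (a b : nat).

Lemma pull_cut_left s : serve_all (@line_request a) (pull (@lshift a b) s) =
  (@lshift a b @^-1: serve_all (@cut_request (a + b) a) s)%SET.
Proof.
apply: serve_all_pull => [|i k|x k]; first exact: lshift_inj.
  rewrite /cut_request /line_request /=; case: ifP => ik.
    by rewrite ifF//; lia.
  have ia := ltn_ord i.
  have [ika|ika] := leqP (i + k) a; last first.
    by rewrite ifF//; case: k ik ika => [|k]; lia.
  rewrite ifT /=; last by lia.
  congr Some; apply/setP => x; rewrite inE; apply/existsP/imsetP => [[l /eqP xl]|[y]].
    have la := ltn_ord l; have xa : (x < a)%N by lia.
    exists (Ordinal xa); last exact: val_inj.
    by rewrite inE; apply/existsP; exists l; apply/eqP.
  by rewrite inE => /existsP[l /eqP yl] ->; exists l; apply/eqP.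
move=> /negP xN; apply/pred0P => y /=; apply/negP => /andP[yx /codomP[j yj]].
have xa : (a <= x)%N.
  by rewrite leqNgt; apply/negP => xa; apply: xN; apply/codomP;
    exists (Ordinal xa); exact: val_inj.
have yline : y \in block (line_request x k).
  by move: yx; rewrite /cut_request; case: ifP => //; rewrite inE.
move: yline; rewrite in_block_line yj /=; have := ltn_ord j; lia.
Qed.

Lemma pull_cut_right s : serve_all (@line_request b) (pull (@rshift a b) s) =
  (@rshift a b @^-1: serve_all (@cut_request (a + b) a) s)%SET.
Proof.
apply: serve_all_pull => [|i k|x k]; first exact: rshift_inj.
  rewrite /cut_request /line_request /= ifF; last by lia.
  rewrite -addnA leq_add2l; case: ifP => //= ik.
  congr Some; apply/setP => x; rewrite inE; apply/existsP/imsetP => [[l /eqP xl]|[y]].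
    have xb : (x - a < b)%N by move: (ltn_ord x); have := ltn_ord l; lia.
    exists (Ordinal xb); last by apply: val_inj => /=; lia.
    by rewrite inE; apply/existsP; exists l; apply/eqP => /=; lia.
  by rewrite inE => /existsP[l /eqP yl] ->; exists l; apply/eqP => /=; lia.
move=> /negP xN; apply/pred0P => y /=; apply/negP => /andP[yx /codomP[j yj]].
have xa : (x < a)%N.
  rewrite ltnNge; apply/negP => xa; apply: xN; apply/codomP.
  have xb : (x - a < b)%N by have := ltn_ord x; lia.
  by exists (Ordinal xb); apply: val_inj => /=; lia.
move: yx; rewrite /cut_request xa /=; case: ifP => [|xk]; first by rewrite inE.
rewrite in_block_line yj /=; lia.
Qed.

Lemma card_preim_shift (A : {set 'I_(a + b)}) :
  (#|A| = #|(@lshift a b @^-1: A)| + #|(@rshift a b @^-1: A)|)%N%SET.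
Proof.
rewrite -(card_imset _ (@lshift_inj a b)) -(card_imset _ (@rshift_inj a b)).
rewrite -cardsUI.
have -> : (@lshift a b @: (@lshift a b @^-1: A) :&:
    @rshift a b @: (@rshift a b @^-1: A) = finset.set0)%SET.
  apply/setP => x; rewrite !inE.
  apply/negP => /andP[/imsetP[i _ ->] /imsetP[j _ /eqP]].
  by rewrite eq_lrshift.
rewrite cards0 addn0; congr #|pred_of_set _|; apply/setP => x; rewrite !inE.
apply/idP/orP => [|[] /imsetP[i + ->]]; rewrite ?inE//.
by case: (split_ordP x) => j -> xA; [left|right]; apply/imsetP; exists j; rewrite ?inE.
Qed.

Lemma card_serve_cut s : (#|serve_all (@cut_request (a + b) a) s| =
  #|serve_all (@line_request a) (pull (@lshift a b) s)| +
  #|serve_all (@line_request b) (pull (@rshift a b) s)|)%N.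
Proof. by rewrite pull_cut_left pull_cut_right -card_preim_shift. Qed.

End cut_line.

Local Open Scope classical_set_scope.
Local Open Scope ring_scope.

(** * Chronological order of the requests *)

Section chronology.
Context (R : realType).

Section defs.
Variable n : nat.
Implicit Types (g : 'I_n -> nat -> R) (k : 'I_n -> nat -> nat) (r : 'I_n * nat).

(** [arr] and [reqs] are [arrival] and [requests] for arbitrary functions in place
    of the values of random variables; they apply to restrictions to fewer
    locations and to points of the space of samples. *)
Definition arr g r : R := \sum_(l < r.2.+1) g r.1 l.

Definition reqs (t : R) g : seq ('I_n * nat) :=
  sort (fun r r' => arr g r <= arr g r') (fset_set [set r | arr g r <= t]).

Definition orders t g k : seq ('I_n * nat) :=
  [seq (r.1, k r.1 r.2) | r <- reqs t g].

Lemma picked_upE (lam : R) (F : probability nat R) (M : marked_poisson lam F n)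
    request t w :
  picked_up request t w = serve_all request
    (orders t (fun i j => gap M i j w) (fun i j => mark M i j w)).
Proof.
rewrite /picked_up /serve_all /orders; change (requests t w) with
  (reqs t (fun i j => gap M i j w)).
by elim: (reqs t _) finset.set0 => //= r s IH A; rewrite IH.
Qed.

Lemma mem_reqs t g r : r \in reqs t g -> arr g r <= t.
Proof.
rewrite /reqs mem_sort; have [fin|inf] := pselect (finite_set [set r | arr g r <= t]).
  by rewrite in_fset_set// inE.
by rewrite /fset_set; case: pselect => // ?; rewrite inE.
Qed.

Lemma mem_reqsE t g r : finite_set [set r | arr g r <= t] ->
  (r \in reqs t g) = (arr g r <= t).
Proof.
by move=> fin; rewrite /reqs mem_sort in_fset_set//; apply/idP/idP; rewrite inE.
Qed.

Lemma reqs_sorted t g :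
    (forall r r', arr g r <= t -> arr g r' = arr g r -> r' = r) ->
  sorted <%R (map (arr g) (reqs t g)).
Proof.
move=> notie; rewrite lt_sorted_uniq_le map_inj_in_uniq; last first.
  by move=> r r' _ /mem_reqs le /notie; exact.
rewrite sort_uniq fset_uniq/= sorted_map.
by apply: sort_sorted => r r'; exact: le_total.
Qed.

Lemma gap_le_arr g i j l : (forall i j, 0 <= g i j) -> (l <= j)%N ->
  g i l <= arr g (i, j).
Proof.
move=> g0 lj; rewrite /arr /= (bigD1 (Ordinal (lj : (l < j.+1)%N)))//=.
by rewrite lerDl sumr_ge0.
Qed.

Lemma orders_active t g k i b : (forall i j, 0 <= g i j) ->
  (i, b) \in orders t g k -> g i 0 <= t /\ exists j, b = k i j.
Proof.
move=> g0 /mapP[[i' j] /mem_reqs le /= [-> ->]]; split; last by exists j.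
exact: le_trans (gap_le_arr _ g0 (leq0n j)) le.
Qed.

(** A gap longer than [t] at each location ends the requests of that location
    before [t]. *)
Lemma finite_requests t g : (forall i j, 0 <= g i j) ->
  (forall i, exists j, t < g i j) -> finite_set [set r | arr g r <= t].
Proof.
move=> g0 /choice[J Jt]; pose K := \max_i J i.
apply: (@sub_finite_set _ _ ((fun p : 'I_n * 'I_K => (p.1, val p.2)) @` setT)).
  move=> [i j] /= le; have jK : (j < K)%N.
    apply: leq_trans (leq_bigmax i); rewrite ltnNge; apply/negP => Jj.
    by have := le_lt_trans (le_trans (gap_le_arr i g0 Jj) le) (Jt i); rewrite ltxx.
  by exists (i, Ordinal jK).
exact/finite_image/finite_finset.
Qed.

End defs.

Section restriction.
Variables (a n : nat) (f : 'I_a -> 'I_n).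
Hypothesis f_inj : injective f.

Lemma mem_pull (s : seq ('I_n * nat)) i j :
  ((i, j) \in pull f s) = ((f i, j) \in s).
Proof.
elim: s => [//|[x l] s IH] /=.
have [/codomP[y ->]|xN] := boolP (x \in codom f).
  by rewrite pickE//= !inE IH !xpair_eqE inj_eq.
rewrite pickN//= inE IH xpair_eqE; case: eqP => //= fx.
by move: xN; rewrite -fx codom_f.
Qed.

Lemma pull_map (k : 'I_n -> nat -> nat) (s : seq ('I_n * nat)) :
  pull f [seq (r.1, k r.1 r.2) | r <- s] =
  [seq (r.1, k (f r.1) r.2) | r <- pull f s].
Proof.
elim: s => [//|[x l] s IH] /=.
have [/codomP[y ->]|xN] := boolP (x \in codom f); first by rewrite pickE//= IH.
by rewrite pickN//= IH.
Qed.

Lemma map_pull_subseq (T : eqType) (h : 'I_n * nat -> T) (s : seq ('I_n * nat)) :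
  subseq [seq h (f r.1, r.2) | r <- pull f s] (map h s).
Proof.
elim: s => [//|[x l] s IH]; rewrite [map h _]/=.
have [/codomP[y ->]|xN] := boolP (x \in codom f).
  by rewrite /= pickE//= eqxx.
by rewrite /= pickN//=; apply: subseq_trans IH (subseq_cons _ _).
Qed.

(** Since no two requests are simultaneous, the chronological order is
    determined by the arrival times alone, whatever the enumeration of the
    requests that is being sorted. *)
Lemma reqs_pull t (g : 'I_n -> nat -> R) :
    finite_set [set r | arr g r <= t] ->
    (forall r r', arr g r <= t -> arr g r' = arr g r -> r' = r) ->
  reqs t (fun i => g (f i)) = pull f (reqs t g).
Proof.
move=> fin notie; pose g' i := g (f i).
have arrE r : arr g' r = arr g (f r.1, r.2) by [].
have fin' : finite_set [set r | arr g' r <= t].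
  apply: (@finite_preimage _ _ [set r | arr g r <= t] (fun r => (f r.1, r.2))) => //.
  by move=> [i j] [i' j'] _ _ [/f_inj -> ->].
have notie' r r' : arr g' r <= t -> arr g' r' = arr g' r -> r' = r.
  rewrite !arrE => le /notie => /(_ le).
  by case: r r' {le} => i j [i' j'] [/f_inj -> ->].
apply: (@irr_sorted_eq _ (relpre (arr g') <%R)).
- by move=> x y z; exact: lt_trans.
- by move=> x; exact: ltxx.
- by rewrite -sorted_map; exact: reqs_sorted.
- rewrite -sorted_map; apply: subseq_sorted (reqs_sorted notie).
    by move=> x y z; exact: lt_trans.
  exact: (map_pull_subseq (arr g)).
- by move=> [i j]; rewrite mem_pull !mem_reqsE.
Qed.

Lemma orders_pull t (g : 'I_n -> nat -> R) k :
    finite_set [set r | arr g r <= t] ->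
    (forall r r', arr g r <= t -> arr g r' = arr g r -> r' = r) ->
  orders t (fun i => g (f i)) (fun i => k (f i)) = pull f (orders t g k).
Proof. by move=> fin notie; rewrite /orders reqs_pull// pull_map. Qed.

End restriction.
End chronology.

(** * Measurability of the outcome *)

Section discrete_measurability.
Context d (T : measurableType d).

(** The natural notion of measurability for values in a countable type such as
    finite sets or lists, without putting a sigma-algebra on that type. *)
Definition discretely_measurable (D : Type) (h : T -> D) :=
  forall x, measurable [set w | h w = x].

Lemma countable_forall_measurable (C : countType) (P : C -> T -> Prop) :
  (forall x, measurable [set w | P x w]) ->
  measurable [set w | forall x, P x w].
Proof.
move=> mP; rewrite (_ : [set w | _] = ~` \bigcup_x ~` [set w | P x w]).
  apply: measurableC; apply: countable_bigcupT_measurable => // x.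
  exact: measurableC.
apply/seteqP; split=> w /= h; first by move=> [x _]; apply; exact: h.
by move=> x; apply: contrapT => nP; apply: h; exists x.
Qed.

(** The outcome is computed in stages: first the set of requests, then their
    order, then their sizes. Each stage is measurable once the results of the
    previous ones are fixed, and these take countably many values. *)
Lemma discretely_measurable_bind (C : countType) (D : Type) (h1 : T -> C)
    (h2 : C -> T -> D) : discretely_measurable h1 ->
  (forall x, discretely_measurable (h2 x)) ->
  discretely_measurable (fun w => h2 (h1 w) w).
Proof.
move=> m1 m2 y; rewrite (_ : [set w | _] =
    \bigcup_x ([set w | h1 w = x] `&` [set w | h2 x w = y])).
  apply: countable_bigcupT_measurable => // x.
  by apply: measurableI; [exact: m1|exact: m2].
apply/seteqP; split=> [w /= h|w [x _ [/= <-]]//].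
by exists (h1 w).
Qed.

Lemma discretely_measurable_cst (D : Type) (x : D) :
  discretely_measurable (fun=> x).
Proof.
move=> y; have [<-|xy] := pselect (x = y).
  by rewrite (_ : [set _ | _] = setT)//; apply/seteqP; split.
by rewrite (_ : [set _ | _] = set0)//; apply/seteqP; split.
Qed.

Lemma discretely_measurable_comp (C : countType) (D : Type) (h : T -> C)
    (f : C -> D) : discretely_measurable h -> discretely_measurable (f \o h).
Proof.
move=> mh; apply: (discretely_measurable_bind (h2 := fun x _ => f x)) => // x.
exact: discretely_measurable_cst.
Qed.

Lemma measurable_fun_discrete d' (T' : measurableType d') (C : countType)
    (h : T -> C) (f : C -> T') :
  discretely_measurable h -> measurable_fun setT (f \o h).
Proof.
move=> mh _ B mB; rewrite setTI.
rewrite (_ : _ @^-1` _ = \bigcup_(x in [set x | B (f x)]) [set w | h w = x]).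
  rewrite bigcup_mkcond; apply: countable_bigcupT_measurable => // x.
  by case: ifP => _; [exact: mh|exact: measurable0].
by apply/seteqP; split=> [w Bw|w [x Bx /= hx]]; [exists (h w)|rewrite /= hx].
Qed.

Lemma discretely_measurable_bool (b : T -> bool) :
  measurable_fun setT b -> discretely_measurable b.
Proof.
move=> mb x; have := mb measurableT [set x]; rewrite setTI; exact.
Qed.

Lemma discretely_measurable_nat (h : T -> nat) :
  measurable_fun setT h -> discretely_measurable h.
Proof.
move=> mb x; have := mb measurableT [set x]; rewrite setTI; exact.
Qed.

Lemma discretely_measurable_map (C : countType) (D : Type) (h : D -> T -> C) s :
  (forall x, discretely_measurable (h x)) ->
  discretely_measurable (fun w => [seq h x w | x <- s]).
Proof.
move=> mh; elim: s => [|x s IH]; first exact: discretely_measurable_cst.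
apply: (discretely_measurable_bind (h1 := h x)
  (h2 := fun y w => y :: [seq h x w | x <- s])) => // y.
exact: discretely_measurable_comp.
Qed.

End discrete_measurability.

Section picked_up_measurable.
Context (R : realType) (n : nat) d (T : measurableType d).
Variables (g : T -> 'I_n -> nat -> R) (k : T -> 'I_n -> nat -> nat).
Hypothesis mg : forall i j, measurable_fun setT (fun w => g w i j).
Hypothesis mk : forall i j, measurable_fun setT (fun w => k w i j).

Lemma measurable_arr r : measurable_fun setT (fun w => arr (g w) r).
Proof. by rewrite /arr; apply: measurable_sum => l; exact: mg. Qed.

Lemma discretely_measurable_requested t :
  discretely_measurable (fun w => fset_set [set r | arr (g w) r <= t]).
Proof.
pose S w := fset_set [set r | arr (g w) r <= t].
(* the empty set is also the default value when infinitely many requests come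
   before [t], so this value is treated as the complement of all the others *)
have mS A : A != fset0 -> measurable [set w | S w = A].
  move=> A0; rewrite (_ : [set w | _] =
      [set w | forall r, (arr (g w) r <= t) = (r \in A)]).
    apply: countable_forall_measurable => r.
    have := discretely_measurable_bool (measurable_fun_ler (measurable_arr r)
      (measurable_cst t)).
    exact.
  apply/seteqP; split=> w /= Sw.
    have fin : finite_set [set r | arr (g w) r <= t].
      apply: contrapT => inf; move: A0; rewrite -Sw /S /fset_set.
      by case: pselect => //; rewrite eqxx.
    by move=> r; rewrite -Sw in_fset_set//; apply/idP/idP; rewrite inE.
  rewrite /S (_ : [set r | _] = [set` A]) ?set_fsetK//.
  by apply/seteqP; split=> r /=; rewrite Sw.
move=> A; have [->|/mS//] := eqVneq A fset0.
rewrite (_ : [set w | _] =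
    ~` \bigcup_(B in [set B | B != fset0]) [set w | S w = B]).
  apply/measurableC; rewrite bigcup_mkcond.
  apply: (countable_bigcupT_measurable (U := {fset 'I_n * nat})) => [|B].
    exact: (@countableP {fset 'I_n * nat}).
  by case: ifP => //; rewrite inE; exact: mS.
apply/seteqP; split=> w /=; first by move=> Sw [B /=]; rewrite /S Sw => /eqP + /esym.
move=> h; apply/eqP/negPn/negP => S0; apply: h; by exists (S w).
Qed.

(** Sorting [s] only depends on the finite table of comparisons between the
    positions of [s]. *)
Lemma discretely_measurable_sort (s : seq ('I_n * nat)) : discretely_measurable
  (fun w => sort (fun r r' => arr (g w) r <= arr (g w) r') s).
Proof.
pose x_ i := tnth (in_tuple s) i.
pose c w := [ffun p : 'I_(size s) * 'I_(size s) =>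
  arr (g w) (x_ p.1) <= arr (g w) (x_ p.2)].
pose h (b : {ffun 'I_(size s) * 'I_(size s) -> bool}) :=
  map x_ (sort (fun i j => b (i, j)) (enum 'I_(size s))).
rewrite (_ : (fun w => _) = h \o c).
  apply: discretely_measurable_comp => b.
  rewrite (_ : [set w | _] = [set w | forall p, c w p = b p]); last first.
    by apply/seteqP; split=> w /= => [->//|cb]; apply/ffunP.
  apply: countable_forall_measurable => p.
  under eq_set do rewrite ffunE.
  have := discretely_measurable_bool
    (measurable_fun_ler (measurable_arr (x_ p.1)) (measurable_arr (x_ p.2))).
  exact.
apply/funext => w; rewrite /h /=.
have sE : s = map x_ (enum 'I_(size s)) by rewrite map_tnth_enum.
rewrite [in LHS]sE sort_map; congr map.
by congr sort; apply/funext => i; apply/funext => j; rewrite ffunE.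
Qed.

Lemma discretely_measurable_serve request t :
  discretely_measurable (fun w => serve_all request (orders t (g w) (k w))).
Proof.
apply: (discretely_measurable_bind
  (h2 := fun s w => serve_all request [seq (r.1, k w r.1 r.2) | r <- s])).
  apply: (discretely_measurable_bind (h2 := fun (A : {fset 'I_n * nat}) w =>
    sort (fun r r' => arr (g w) r <= arr (g w) r') A)).
    exact: discretely_measurable_requested.
  by move=> A; exact: discretely_measurable_sort.
move=> s.
apply: (discretely_measurable_comp (h := fun w => [seq (r.1, k w r.1 r.2) | r <- s])).
apply: (discretely_measurable_map (h := fun r w => (r.1, k w r.1 r.2))) => r.
apply: (discretely_measurable_comp (h := fun w => k w r.1 r.2) (pair r.1)).
exact/discretely_measurable_nat.
Qed.

Lemma measurable_card_serve request t : measurable_fun setT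
  (fun w => #|serve_all request (orders t (g w) (k w))|%:R : R).
Proof.
apply: (measurable_fun_discrete (h := fun w => serve_all request (orders t (g w) (k w)))
  (fun A : {set 'I_n} => #|A|%:R : R)).
exact: discretely_measurable_serve.
Qed.

End picked_up_measurable.

(** * The mean depends only on the laws of the gaps and marks *)

Section cylinders.
Context (T : Type) (I : choiceType).
Implicit Types H : I -> set (set T).

(** The finite intersections of events, one from each of finitely many families.
    The independence of the families [H i] prescribes the probabilities of these
    events, and they form a pi-system. *)
Definition cylinders H : set (set T) :=
  [set C | exists J : {fset I}, exists2 A : I -> set T,
    (forall i, i \in J -> H i (A i)) & C = \bigcap_(i in [set` J]) A i].

Lemma cylinders_setI H : (forall i, setI_closed (H i)) ->
  setI_closed (cylinders H).
Proof.
move=> HI _ _ [J1 [A1 HA1 ->]] [J2 [A2 HA2 ->]].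
exists (J1 `|` J2)%fset, (fun i => (if i \in J1 then A1 i else setT) `&`
  (if i \in J2 then A2 i else setT)) => [i|].
  rewrite in_fsetU; have [i1|i1] := boolP (i \in J1);
    have [i2|i2] := boolP (i \in J2) => //= _.
  - by apply: HI; [exact: HA1|exact: HA2].
  - by rewrite setIT; exact: HA1.
  - by rewrite setTI; exact: HA2.
apply/seteqP; split=> [x [x1 x2] i /=|x x12].
  by move=> _; split; case: ifP => // ?; [exact: x1|exact: x2].
split=> i /= iJ; have := x12 i; rewrite /= in_fsetU iJ ?orbT/=.
- by move=> /(_ isT)[].
- by move=> /(_ isT)[].
Qed.

Lemma cylindersT H : cylinders H setT.
Proof.
exists fset0, (fun=> setT) => //.
by apply/seteqP; split.
Qed.

Lemma cylinders1 H i A : H i A -> cylinders H A.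
Proof.
move=> HA; exists [fset i]%fset, (fun=> A) => [j|].
  by rewrite inE => /eqP ->.
apply/seteqP; split=> [x Ax j _ //|x Ax]; apply: (Ax i).
by rewrite /= inE.
Qed.

End cylinders.

Lemma preimage_set_system_setI (aT rT : Type) (X : aT -> rT) (G : set (set rT)) :
  setI_closed G -> setI_closed (preimage_set_system setT X G).
Proof.
move=> GI _ _ [A GA <-] [B GB <-]; exists (A `&` B); first exact: GI.
by rewrite preimage_setI !setTI.
Qed.

Lemma cylinders_measurable d (T : measurableType d) (I : choiceType)
    (H : I -> set (set T)) :
  (forall i, H i `<=` measurable) -> cylinders H `<=` measurable.
Proof.
move=> Hm _ [J [A HA ->]]; apply: fin_bigcap_measurable.
  exact: finite_fset.
by move=> i /= iJ; apply: (Hm i); exact: HA.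
Qed.

(** Dynkin's pi-lambda theorem, applied to the pi-system of cylinders. *)
Lemma cylinders_measure_unique d (T : measurableType d) (R : realType)
    (I : choiceType) (H : I -> set (set T)) (m1 m2 : {measure set T -> \bar R}) :
    (forall i, H i `<=` measurable) -> (forall i, setI_closed (H i)) ->
    (m1 setT < +oo)%E ->
    (forall C, cylinders H C -> m1 C = m2 C) ->
  forall E, <<s cylinders H >> E -> m1 E = m2 E.
Proof.
move=> Hm HI m1oo m12 E HE.
apply: (g_sigma_algebra_measure_unique (cylinders H) _ (fun=> setT)) => //.
- exact: cylinders_measurable.
- by move=> _; exact: cylindersT.
- by apply/seteqP; split=> // x _; exists 0%N.
- exact: cylinders_setI.
Qed.

Section law.
Context (R : realType) (lam : R) (F : probability nat R) (n : nat).

Definition sample := 'I_n * nat -> R * nat.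

Definition coordinate_events (i : ('I_n * nat) + ('I_n * nat)) :
    set (set sample) :=
  match i with
  | inl r => preimage_set_system setT (fun x : sample => (x r).1) measurable
  | inr r => preimage_set_system setT (fun x : sample => (x r).2) measurable
  end.

(** The common space on which the joint laws of the gaps and marks of different
    realizations can be compared. *)
Definition sampleType := g_sigma_algebraType (cylinders coordinate_events).

Lemma measurable_sample_gap r :
  measurable_fun setT (fun x : sampleType => (x r).1).
Proof.
move=> _ B mB; apply: sub_sigma_algebra; apply: (@cylinders1 _ _ _ (inl r)).
by exists B.
Qed.

Lemma measurable_sample_mark r :
  measurable_fun setT (fun x : sampleType => (x r).2).
Proof.
move=> _ B mB; apply: sub_sigma_algebra; apply: (@cylinders1 _ _ _ (inr r)).
by exists B.
Qed.

Lemma coordinate_events_measurable i (A : set sampleType) :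
  coordinate_events i A -> measurable A.
Proof.
by move=> iA; apply: sub_sigma_algebra; exact: cylinders1 iA.
Qed.

Lemma coordinate_events_setI i : setI_closed (coordinate_events i).
Proof.
by case: i => r; apply: preimage_set_system_setI => A B; exact: measurableI.
Qed.

Section sample_of.
Variable M : marked_poisson lam F n.

Definition sample_of (w : mp_space M) : sampleType :=
  fun r => (gap M r.1 r.2 w, mark M r.1 r.2 w).

(** The sets [A] of interest depend on one coordinate only, so that filling the
    other coordinates with arbitrary constants loses nothing. *)
Definition coordinate_law (i : ('I_n * nat) + ('I_n * nat)) (A : set sample) :=
  match i with
  | inl r => exponential_prob lam ((fun y : R => (fun=> (y, 0%N)) : sample) @^-1` A)
  | inr r => F ((fun k : nat => (fun=> (0, k)) : sample) @^-1` A)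
  end.

Lemma sample_of_coordinate i A : coordinate_events i A ->
  match i with
  | inl r => generated_sigma_algebra (gap M r.1 r.2)
  | inr r => generated_sigma_algebra (mark M r.1 r.2)
  end (sample_of @^-1` A) /\
  mp_prob M (sample_of @^-1` A) = coordinate_law i A.
Proof.
case: i => -[j l] /= [B mB <-]; rewrite setTI; (split; first by exists B; rewrite ?setTI).
  by rewrite -(gap_law M j l) ?setTI.
by rewrite -(mark_law M j l) ?setTI.
Qed.

Lemma measurable_sample_of : measurable_fun setT sample_of.
Proof.
apply: (@measurability _ _ _ sampleType setT _ (cylinders coordinate_events) erefl) => _ [_ [J [A HA ->]] <-].
rewrite setTI preimage_bigcap; apply: fin_bigcap_measurable.
  exact: finite_fset.
move=> i /= /HA/sample_of_coordinate[+ _].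
case: i => -[j l] /= [B mB <-]; exact: measurable_funP.
Qed.

HB.instance Definition _ :=
  isMeasurableFun.Build _ _ _ _ sample_of measurable_sample_of.

Lemma prob_sample_of_cylinder (J : {fset ('I_n * nat) + ('I_n * nat)}) A :
    (forall i, i \in J -> coordinate_events i (A i)) ->
  mp_prob M (sample_of @^-1` (\bigcap_(i in [set` J]) A i)) =
  (\prod_(i <- J) coordinate_law i (A i))%E.
Proof.
move=> HA; rewrite preimage_bigcap (@gap_mark_independent _ _ _ _ M); last first.
  by move=> i /HA/sample_of_coordinate[].
rewrite big_seq [RHS]big_seq; apply: eq_bigr => i /HA/sample_of_coordinate[].
by [].
Qed.

End sample_of.

(** The number of packages is the same measurable function of the sample for both
    realizations, and the two samples have the same law. *)
Lemma mean_picked_up_unique (M1 M2 : marked_poisson lam F n) request t :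
  mean_picked_up M1 request t = mean_picked_up M2 request t.
Proof.
pose gaps (x : sampleType) i j := (x (i, j)).1.
pose marks (x : sampleType) i j := (x (i, j)).2.
pose f x : R := #|serve_all request (orders t (gaps x) (marks x))|%:R.
have mf : measurable_fun setT f.
  apply: measurable_card_serve => i j.
    exact: measurable_sample_gap.
  exact: measurable_sample_mark.
have meanE (M : marked_poisson lam F n) : mean_picked_up M request t =
    fine (\int[distribution (mp_prob M) (@sample_of M)]_x (f x)%:E).
  rewrite ge0_integral_distribution//; last 2 first.
    exact/measurable_EFinP.
    by move=> x; rewrite lee_fin.
  rewrite /mean_picked_up unlock; congr (fine _); apply: eq_integral => w _.
  by rewrite picked_upE.
rewrite !meanE; congr fine; apply: eq_measure_integral => E mE _.
apply: (@cylinders_measure_unique _ sampleType _ _ coordinate_events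
  (distribution (mp_prob M1) (@sample_of M1))
  (distribution (mp_prob M2) (@sample_of M2)) _ _ _ _ E mE) => //.
- exact: coordinate_events_measurable.
- exact: coordinate_events_setI.
- have := @probability_le1 _ _ _ (distribution (mp_prob M1) (@sample_of M1)) setT.
  by move=> /(_ measurableT)/le_lt_trans; apply; rewrite ltry.
- move=> _ [J [A HA ->]].
  exact: etrans (prob_sample_of_cylinder M1 HA)
    (esym (prob_sample_of_cylinder M2 HA)).
Qed.

End law.

(** * Restriction to fewer locations, and laws of the gaps *)

Section independence.
Context d (T : measurableType d) (R : realType) (P : probability T R).

Lemma mutually_independent_sub (I I' : choiceType) (h : I -> I')
    (G : I -> set (set T)) (G' : I' -> set (set T)) :
  injective h -> (forall i, G i `<=` G' (h i)) ->
  mutually_independent P G' -> mutually_independent P G.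
Proof.
move=> h_inj GG' indep J A GA.
pose A' i' := \bigcap_(i in [set i | h i = i']) A i.
have A'h i : A' (h i) = A i.
  apply/seteqP; split=> [w|w Aw j /h_inj -> //]; by apply.
have -> : \bigcap_(i in [set` J]) A i = \bigcap_(i in [set` (h @` J)%fset]) A' i.
  apply/seteqP; split=> [w JAw _ /imfsetP[i iJ ->]|w JAw i iJ].
    by rewrite A'h; exact: JAw.
  by rewrite -A'h; apply: JAw; apply/imfsetP; exists i.
rewrite indep => [|_ /imfsetP[i iJ ->]].
  rewrite big_imfset/=; last by move=> x y _ _; exact: h_inj.
  by apply: eq_bigr => i _; rewrite A'h.
by rewrite A'h; apply: GG'; exact: GA.
Qed.

End independence.

Section restriction.
Context (R : realType) (lam : R) (F : probability nat R) (a n : nat).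
Variables (f : 'I_a -> 'I_n) (f_inj : injective f) (M : marked_poisson lam F n).

Lemma restrict_independent : mutually_independent (mp_prob M)
  (fun r : ('I_a * nat) + ('I_a * nat) =>
     match r with
     | inl ij => generated_sigma_algebra (gap M (f ij.1) ij.2)
     | inr ij => generated_sigma_algebra (mark M (f ij.1) ij.2)
     end).
Proof.
pose h (r : ('I_a * nat) + ('I_a * nat)) : ('I_n * nat) + ('I_n * nat) :=
  match r with inl ij => inl (f ij.1, ij.2) | inr ij => inr (f ij.1, ij.2) end.
apply: (mutually_independent_sub (h := h)) (@gap_mark_independent _ _ _ _ M).
  by case=> -[i j] [] [i' j'] //= [/f_inj -> ->].
by case=> r A.
Qed.

(** A part of the locations of a realization is a realization by itself. This
    compares lines of different lengths on one probability space. *)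
Definition restrict : marked_poisson lam F a :=
  MarkedPoisson (fun i j => gap_law M (f i) j) (fun i j => mark_law M (f i) j)
    restrict_independent.

End restriction.

Section exponential_bounds.
Context (R : realType) (lam : R) (lam0 : 0 < lam).
Local Open Scope ereal_scope.

(** The density is at most [lam]. *)
Lemma exponential_prob_itvoc_le (a b : R) : (a <= b)%R ->
  exponential_prob lam `]a, b]%classic <= (lam * (b - a))%:E.
Proof.
move=> ab; rewrite /exponential_prob.
apply: (@le_trans _ _ (\int[lebesgue_measure]_(x in `]a, b]) lam%:E)).
  apply: ge0_le_integral => //=.
  - by move=> x _; rewrite lee_fin exponential_pdf_ge0// ltW.
  - by apply/measurable_EFinP; apply: measurable_funTS; exact: measurable_exponential_pdf.
  - move=> x _; rewrite lee_fin; have [x0|x0] := leP 0%R x; last first.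
      by rewrite lt0_exponential_pdf// ltW.
    rewrite exponential_pdfE// ler_piMr ?(ltW lam0)// -expR0 ler_expR mulNr oppr_le0.
    by rewrite mulr_ge0// ltW.
rewrite integral_cst//= lebesgue_measure_itv/= lte_fin; case: ifP => _.
  by rewrite -EFinD -EFinM.
by rewrite mule0 lee_fin mulr_ge0 ?subr_ge0// ltW.
Qed.

Lemma exponential_prob_itvNyc0 : exponential_prob lam `]-oo, 0%R]%classic = 0.
Proof.
rewrite /exponential_prob.
rewrite -(@integral_itv_bndo_bndc R -oo%O 0%R).
  rewrite (eq_integral (cst 0)) ?integral0// => x; rewrite inE/= in_itv/= => x0.
  by rewrite lt0_exponential_pdf.
by apply/measurable_EFinP; apply: measurable_funTS; exact: measurable_exponential_pdf.
Qed.

Lemma exponential_probU (A B : set R) : measurable A -> measurable B ->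
  [disjoint A & B] -> exponential_prob lam (A `|` B) =
  exponential_prob lam A + exponential_prob lam B.
Proof.
move=> mA mB AB; rewrite /exponential_prob ge0_integral_setU//=.
  by apply/measurable_EFinP; apply: measurable_funTS; exact: measurable_exponential_pdf.
by move=> x _; rewrite lee_fin exponential_pdf_ge0// ltW.
Qed.

Lemma exponential_prob_itvNyc (t : R) : (0 <= t)%R ->
  exponential_prob lam `]-oo, t]%classic = (1 - expR (- lam * t))%:E.
Proof.
rewrite le_eqVlt => /predU1P[<-|t0].
  by rewrite exponential_prob_itvNyc0 mulr0 expR0 subrr.
rewrite EFinB -(exponential_prob_itv0c lam t0) -[RHS]add0e.
have <- : exponential_prob lam `]-oo, 0%R[%classic = 0.
  apply/eqP; rewrite eq_le integral_ge0 ?andbT; last first.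
    by move=> x _; rewrite lee_fin exponential_pdf_ge0// ltW.
  rewrite -exponential_prob_itvNyc0 /exponential_prob integral_itv_bndo_bndc//.
  by apply/measurable_EFinP; apply: measurable_funTS; exact: measurable_exponential_pdf.
rewrite -exponential_probU//=.
  by rewrite -itv_bndbnd_setU// bnd_simp ltW.
apply/disj_setPS => x [] /=; rewrite !in_itv/= => x0 /andP[].
by rewrite leNgt x0.
Qed.

Lemma exponential_prob_itvoy (t : R) : (0 <= t)%R ->
  exponential_prob lam `]t, +oo[%classic = (expR (- lam * t))%:E.
Proof.
move=> t0.
have : exponential_prob lam setT = 1 by exact: integral_exponential_pdf.
rewrite (_ : setT = `]-oo, t]%classic `|` `]t, +oo[%classic); last first.
  by rewrite -itv_bndbnd_setU// -set_itvNyy.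
rewrite exponential_probU//=; last first.
  apply/disj_setPS => x [] /=; rewrite !in_itv/= andbT => xt.
  by rewrite ltNge xt.
rewrite exponential_prob_itvNyc//.
case: (exponential_prob lam `]t, +oo[%classic) => [y| |]//.
by rewrite -EFinD => -[yE]; congr EFin; lra.
Qed.

End exponential_bounds.

Section gaps.
Context (R : realType) (lam : R) (F : probability nat R) (n : nat).
Variable M : marked_poisson lam F n.
Local Open Scope ereal_scope.

Lemma prob_gaps_in (J : {fset 'I_n * nat}) (B : set R) : measurable B ->
  mp_prob M (\bigcap_(r in [set` J]) (gap M r.1 r.2 @^-1` B)) =
  \prod_(r <- J) exponential_prob lam B.
Proof.
move=> mB.
have indep : mutually_independent (mp_prob M)
    (fun r : 'I_n * nat => generated_sigma_algebra (gap M r.1 r.2)).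
  apply: (mutually_independent_sub (h := inl)) (@gap_mark_independent _ _ _ _ M).
    by move=> r s [].
  by move=> r A.
rewrite indep => [|r _]; last by exists B; rewrite ?setTI.
by apply: eq_bigr => r _; exact: gap_law.
Qed.

End gaps.

(** * Distance to the nearest idle block *)

Section idle_runs.
Context (R : realType) (lam : R) (lam0 : 0 < lam) (F : probability nat R).
Context (n : nat) (M : marked_poisson lam F n) (t : R) (t0 : 0 <= t).

Let P := mp_prob M.
Let e : R := expR (- lam * t).

(** The first gap is the time of the first request, so no request is addressed to
    these locations up to time [t]. *)
Definition idle (w : mp_space M) : {set 'I_n} :=
  [set i : 'I_n | t < gap M i 0 w]%SET.

Lemma discretely_measurable_idle : discretely_measurable idle.
Proof.
move=> A; rewrite (_ : [set w | _] =
    [set w | forall i, (t < gap M i 0 w) = (i \in A)]).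
  apply: countable_forall_measurable => i.
  have mgap : measurable_fun setT (gap M i 0) by [].
  have := discretely_measurable_bool
    (measurable_fun_ltr (measurable_cst t) mgap); exact.
apply/seteqP; split=> w /= => [<- i|h]; first by rewrite inE.
by apply/setP => i; rewrite inE.
Qed.

Lemma measurable_idle (p : pred {set 'I_n}) : measurable [set w | p (idle w)].
Proof. exact: (discretely_measurable_comp p discretely_measurable_idle true). Qed.

Lemma prob_idle (S : {set 'I_n}) :
  P [set w | S \subset idle w] = (e ^+ #|S|)%:E.
Proof.
rewrite (_ : [set w | _] = \bigcap_(r in [set` [fset (i, 0%N) | i in S]%fset])
    (gap M r.1 r.2 @^-1` `]t, +oo[)); last first.
  apply/seteqP; split=> w /= => [/fintype.subsetP Sw _ /imfsetP[i /= iS ->]|Sw].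
    by have := Sw i iS; rewrite inE /= in_itv/= andbT.
  apply/fintype.subsetP => i iS; rewrite inE.
  have := Sw (i, 0%N); rewrite /= in_itv/= andbT; apply.
  by apply/imfsetP; exists i.
rewrite prob_gaps_in// exponential_prob_itvoy// -/e.
rewrite big_imfset /=; last by move=> x y _ _ [].
by rewrite big_enum/= prodEFin prodr_const.
Qed.

Section blocks.
Variables (B : nat -> {set 'I_n}) (K : nat).
Hypothesis B_disjoint : forall i j, (i < j < K)%N -> [disjoint B i & B j]%B.

(** The extra idle set [S] makes the induction work: the probability that block [k]
    is not idle is the difference between the cases [S] and [B k :|: S]. *)
Lemma prob_no_idle_block k (S : {set 'I_n}) : (k <= K)%N ->
    (forall j, (j < k)%N -> [disjoint B j & S]%B) ->
  P [set w | all (fun j => ~~ (B j \subset idle w)) (iota 0 k) &&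
             (S \subset idle w)] =
  ((\prod_(j < k) (1 - e ^+ #|B j|)) * e ^+ #|S|)%:E.
Proof.
elim: k S => [|k IH] S kK dS.
  by rewrite big_ord0 mul1r -prob_idle.
have dS' j : (j < k)%N -> [disjoint B j & S]%B by move=> jk; apply: dS; lia.
have dBS j : (j < k)%N -> [disjoint B j & (B k :|: S)%SET]%B.
  move=> jk; rewrite -setI_eq0 finset.setIUr finset.setU_eq0 !setI_eq0 dS'// andbT.
  by apply: B_disjoint; lia.
pose V (Z : {set 'I_n}) w := all (fun j => ~~ (B j \subset idle w)) (iota 0 k) && (Z \subset idle w).
have mV S' : measurable [set w | V S' w].
  exact: (measurable_idle (fun Z => all (fun j => ~~ (B j \subset Z)) (iota 0 k)
    && (S' \subset Z))).
have allS (p : pred nat) : all p (iota 0 k.+1) = all p (iota 0 k) && p k.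
  by rewrite -addn1 iotaD all_cat/= andbT.
under eq_set do rewrite allS.
rewrite (_ : [set w | _] = [set w | V S w] `\` [set w | V (B k :|: S)%SET w]); last first.
  apply/seteqP; split=> w /=; rewrite /V finset.subUset.
    by move=> /andP[/andP[-> /negPf ->] ->].
  by case: all => /= -[]//= ->; rewrite !andbT => /negP ->.
rewrite measureD//; last by rewrite ltey_eq fin_num_measure.
rewrite (_ : _ `&` _ = [set w | V (B k :|: S)%SET w]); last first.
  apply/seteqP; split=> w /=; first by case.
  by rewrite /V finset.subUset => /and3P[-> -> ->].
apply: etrans (congr2 (fun x y => x - y)%E (IH S (ltnW kK) dS')
  (IH _ (ltnW kK) dBS)) _.
rewrite big_ord_recr /= cardsU (eqP (_ : #|B k :&: S| == 0)%N%SET); last first.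
  by rewrite cards_eq0 setI_eq0 dS.
by rewrite subn0 exprD -EFinB; congr EFin; ring.
Qed.

Variable m : nat.
Hypothesis B_card : forall j, (#|B j| <= m)%N.

Lemma idle_proba_bounds j : 0 <= 1 - e ^+ #|B j| <= 1 - e ^+ m.
Proof.
have e0 : 0 <= e by exact: expR_ge0.
have e1 : e <= 1 by rewrite -expR0 ler_expR mulNr oppr_le0 mulr_ge0// ltW.
by rewrite subr_ge0 exprn_ile1//= lerB// ler_wiXn2l.
Qed.

(** The blocks are independent and each is idle with probability at least
    [e ^+ m]; the expectation is the sum over [b] of the probabilities that the
    blocks up to [b] are not idle, which is at most a geometric series. *)
Lemma expected_idle_run :
  (\int[P]_w (find (fun j => B j \subset idle w) (iota 0 K))%:R%:E <=
   ((e ^+ m)^-1)%:E)%E.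
Proof.
have e0 : 0 < e by exact: expR_gt0.
have e1 : e <= 1 by rewrite -expR0 ler_expR mulNr oppr_le0 mulr_ge0// ltW.
have em0 : 0 < e ^+ m by exact: exprn_gt0.
have x0 : 0 <= 1 - e ^+ m by rewrite subr_ge0 exprn_ile1// ltW.
have x1 : 1 - e ^+ m <= 1 by rewrite lerBlDr lerDl ltW.
pose V b := [set w | all (fun j => ~~ (B j \subset idle w)) (iota 0 b.+1)].
have mV b : measurable (V b).
  exact: (measurable_idle (fun Z => all (fun j => ~~ (B j \subset Z)) (iota 0 b.+1))).
apply: (@le_trans _ _ (\int[P]_w (\sum_(b < K) (\1_(V b) w)%:E))%E).
  apply: ge0_le_integral => //.
  - apply/measurable_EFinP.
    exact: (measurable_fun_discrete (fun Z : {set 'I_n} =>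
      (find (fun j => B j \subset Z) (iota 0 K))%:R : R) discretely_measurable_idle).
  - by apply: emeasurable_sum => b; apply/measurable_EFinP; exact: measurable_indic.
  - move=> w _; rewrite sumEFin lee_fin.
    set p := fun j => _; set x := find _ _.
    have xK : (x <= K)%N by rewrite -[K in leqRHS](size_iota 0) find_size.
    have -> : x%:R = \sum_(b < K | (b < x)%N) 1 :> R.
      by rewrite -(big_ord_widen _ (fun=> 1))// sumr_const card_ord.
    rewrite big_mkcond; apply: ler_sum => b _; case: ifP => // bx.
    suff Vw : V b w by rewrite indicE mem_set.
    apply/allP => j; rewrite mem_iota add0n => /andP[_ jb].
    have := before_find 0%N (leq_ltn_trans (jb : (j <= b)%N) bx).
    by rewrite nth_iota ?add0n => [/negbT//|]; exact: leq_ltn_trans (jb : (j <= b)%N) (ltn_ord b).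
rewrite ge0_integral_sum//; last first.
  by move=> b; apply/measurable_EFinP; exact: measurable_indic.
apply: (@le_trans _ _ (\sum_(b < K) ((1 - e ^+ m) ^+ b)%:E)%E).
  apply: lee_sum => b _; rewrite integral_indic// setIT.
  rewrite [leLHS](_ : _ = (\prod_(j < b.+1) (1 - e ^+ #|B j|))%:E); last first.
    have := @prob_no_idle_block b.+1 finset.set0 (ltn_ord b).
    rewrite cards0 mulr1 => <- => [|j _]; last by rewrite -setI_eq0 finset.setI0.
    by congr (P _); apply/seteqP; split=> w; rewrite /V /= finset.sub0set andbT.
  rewrite lee_fin; apply: (@le_trans _ _ ((1 - e ^+ m) ^+ b.+1)).
    rewrite -[in leRHS](card_ord b.+1) -prodr_const; apply: ler_prod => j _.
    exact: idle_proba_bounds.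
  by rewrite exprS ler_piMl ?exprn_ge0.
rewrite sumEFin lee_fin -[leRHS]mul1r ler_pdivlMr// mulrC.
have := subrX1 (1 - e ^+ m) K; rewrite (_ : 1 - _ - 1 = - e ^+ m); last by ring.
rewrite mulNr => /eqP; rewrite -eqr_opp opprK opprB => /eqP <-.
by rewrite lerBlDr lerDl exprn_ge0.
Qed.

End blocks.
End idle_runs.

(** * Almost sure properties of a realization *)

Section others.
Context d (T : measurableType d) (R : realType) (P : probability T R).
Context (I : choiceType) (G : I -> set (set T)).
Local Open Scope ereal_scope.

(** The family at [i0] is made trivial instead of being removed, so that the index
    type remains the same. *)
Definition others (i0 : I) : I -> set (set T) :=
  fun i => if i == i0 then [set setT] else G i.

(** Both sides are finite measures in [E] that agree on cylinders. *)
Lemma independent_of_others i0 A E : mutually_independent P G ->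
    (forall i, G i `<=` measurable) -> (forall i, setI_closed (G i)) ->
    G i0 A -> <<s cylinders (others i0) >> E ->
  P (E `&` A) = P A * P E.
Proof.
move=> indep Gm GI GA sE; have mA := Gm _ _ GA.
have PA0 : (0 <= fine (P A))%R by exact: fine_ge0.
pose m2 := mscale (NngNum PA0) P.
have m2E C : m2 C = P A * P C.
  transitivity ((fine (P A))%:E * P C); first by [].
  by rewrite fineK// fin_num_measure.
apply: etrans (m2E E).
apply: (@cylinders_measure_unique _ T R I (others i0) (mrestr P mA) m2 _ _ _ _ E sE).
- by move=> i B; rewrite /others; case: eqP => [_ ->//|_]; exact: Gm.
- move=> i; rewrite /others; case: eqP => [_ B C -> ->|_]; last exact: GI.
  by rewrite setIT.
- by rewrite /= /mrestr setTI (le_lt_trans (probability_le1 P mA))// ltry.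
- move=> _ [J [B HB ->]]; apply: etrans (esym (m2E _)).
  change (P ((\bigcap_(i in [set` J]) B i) `&` A) =
          P A * P (\bigcap_(i in [set` J]) B i)).
  pose J' := (J `\ i0)%fset; pose B' i := if i == i0 then A else B i.
  have BJ' : \bigcap_(i in [set` J]) B i = \bigcap_(i in [set` J']) B i.
    apply/seteqP; split=> [x Jx i|x Jx i iJ] /=.
      by rewrite !inE => /andP[_ iJ]; exact: Jx.
    have [ii0|ii0] := eqVneq i i0; last by apply: Jx; rewrite /= !inE ii0.
    by have := HB i iJ; rewrite /others ii0 eqxx => ->.
  have GB i : i \in J' -> G i (B i).
    rewrite !inE => /andP[ii0 iJ]; have := HB i iJ.
    by rewrite /others (negPf ii0).
  rewrite BJ' (indep J' B GB).
  rewrite (_ : _ `&` A = \bigcap_(i in [set` (i0 |` J')%fset]) B' i); last first.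
    apply/seteqP; split=> [x [Jx Ax] i /=|x Jx].
      rewrite in_fset1U /B'; case: eqP => //= _ iJ; exact: Jx.
    split; last by have := Jx i0; rewrite /B' eqxx; apply; rewrite /= !inE eqxx.
    move=> i iJ; have := Jx i; rewrite /B' ifF; last first.
      by move: iJ; rewrite /= !inE => /andP[/negPf].
    by apply; rewrite /= in_fset1U iJ orbT.
  rewrite indep => [|i]; last first.
    by rewrite in_fset1U /B'; case: eqP => [->|] //= _ /GB.
  rewrite big_fsetU1/=; last by rewrite !inE eqxx.
  rewrite {1}/B' eqxx; congr (_ * _); rewrite big_seq [RHS]big_seq.
  apply: eq_bigr => i; rewrite !inE => /andP[ii0 _].
  by rewrite /B' (negPf ii0).
Qed.

End others.

Lemma ae_forall_countable d (T : measurableType d) (R : realType)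
    (P : {measure set T -> \bar R}) (C : countType) (Q : C -> T -> Prop) :
  (forall x, {ae P, forall w, Q x w}) -> {ae P, forall w, forall x, Q x w}.
Proof.
move=> aeQ.
have : {ae P, forall w, forall k : nat, if (choice.unpickle k : option C) is Some x then Q x w else True}.
  apply/ae_foralln => k; case: (choice.unpickle k : option C) => [x|]; first exact: aeQ.
  exact: aeW.
by apply: filterS => w Qw x; have := Qw (choice.pickle x); rewrite choice.pickleK.
Qed.

Lemma ae_not_null d (T : measurableType d) (R : realType)
    (P : {measure set T -> \bar R}) (N : set T) (Q : T -> Prop) :
  measurable N -> P N = 0%E -> (forall w, ~ Q w -> N w) -> {ae P, forall w, Q w}.
Proof. by move=> mN PN QN; exists N; split. Qed.

Lemma partition_itv0c (R : realType) (h x : R) (N : nat) :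
  0 < x -> x <= N%:R * h -> exists2 k, (k < N)%N & k%:R * h < x <= k.+1%:R * h.
Proof.
elim: N => [|N IH] x0; first by rewrite mul0r leNgt x0.
have [xN _|Nx xN] := leP x (N%:R * h).
  by have [k kN kx] := IH x0 xN; exists k => //; exact: ltnW.
by exists N => //; rewrite Nx.
Qed.

Lemma le_inv_nat_eq0 (R : realType) (x : \bar R) (C : R) :
  (forall k, x <= (C / k.+1%:R)%:E)%E -> (x <= 0)%E.
Proof.
move=> xC; apply/lee_addgt0Pr => e e0; rewrite add0e.
apply: le_trans (xC (Num.truncn (C / e))) _; rewrite lee_fin.
by rewrite ler_pdivrMr// mulrC -ler_pdivrMr// ltW// truncnS_gt.
Qed.

Section null_ties.
Context d (T : measurableType d) (R : realType) (P : probability T R).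

(** Cut [0, t] into [k] intervals of length [t / k]. Equality puts [X] and [Y] in
    the same interval; by independence this has probability at most the largest
    mass [L * t / k] that [X] gives to one of the intervals, since the masses
    given by [Y] add up to at most [1]. *)
Lemma null_coincidence (X Y : T -> R) (L t : R) : 0 <= L -> 0 < t ->
    measurable_fun setT X -> measurable_fun setT Y ->
    (forall a b : R, a <= b ->
      (P (X @^-1` `]a, b]%classic) <= (L * (b - a))%:E)%E) ->
    (forall a b : R, (P (Y @^-1` `]a, b]%classic `&` X @^-1` `]a, b]%classic) =
       P (X @^-1` `]a, b]%classic) * P (Y @^-1` `]a, b]%classic))%E) ->
  P [set w | X w = Y w /\ 0 < X w <= t] = 0%E.
Proof.
move=> L0 t0 mX mY PX PXY; set N := [set w | _].
have mpre (Z : T -> R) (a b : R) : measurable_fun setT Z ->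
    measurable (Z @^-1` `]a, b]%classic).
  by move=> mZ; rewrite -[X in measurable X]setTI; exact: mZ.
have mN : measurable N.
  rewrite (_ : N = [set w | X w == Y w] `&` X @^-1` `]0, t]%classic).
    apply: measurableI; last exact: mpre.
    exact: (discretely_measurable_bool (measurable_fun_eqr mX mY) true).
  by apply/seteqP; split=> w /=; rewrite in_itv/= => -[/eqP].
have bound k : (P N <= (L * t / k.+1%:R)%:E)%E.
  pose h := t / k.+1%:R; have h0 : 0 <= h by rewrite divr_ge0// ltW.
  have kh : k.+1%:R * h = t by rewrite /h mulrC divfK.
  pose Ik j := `]j%:R * h, j.+1%:R * h]%classic.
  have sub : N `<=` \big[setU/set0]_(j < k.+1) (Y @^-1` Ik j `&` X @^-1` Ik j).
    move=> w [XY /andP[x0 xt]]; 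
    rewrite -(bigcup_mkord k.+1 (fun j => Y @^-1` Ik j `&` X @^-1` Ik j)).
    have [j jk jX] : exists2 j, (j < k.+1)%N & j%:R * h < X w <= j.+1%:R * h.
      by apply: partition_itv0c => //; rewrite kh.
    by exists j => //; split; rewrite /Ik /= in_itv//= -XY.
  apply: (le_trans (le_measure P _ _ sub)); rewrite ?inE//.
    by apply: bigsetU_measurable => j _; apply: measurableI; exact: mpre.
  apply: (le_trans (@Boole_inequality _ _ _ P
    (fun j => Y @^-1` Ik j `&` X @^-1` Ik j) k.+1 _)).
    by move=> j _; apply: measurableI; exact: mpre.
  apply: (@le_trans _ _ (\sum_(j < k.+1) (L * h)%:E * P (Y @^-1` Ik j))%E).
    apply: lee_sum => j _.
    have /eqP := PXY (j%:R * h) (j.+1%:R * h); rewrite eq_le => /andP[+ _].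
    move=> /le_trans; apply; apply: lee_wpmul2r => //.
    apply: (le_trans (PX _ _ _)); first by rewrite ler_wpM2r// ler_nat.
    by rewrite lee_fin -mulrBl -natrB// subSnn mul1r.
  rewrite -ge0_sume_distrr//.
  rewrite -(@measure_semi_additive_ord _ _ _ P k.+1 (fun j : 'I_k.+1 => Y @^-1` Ik j)).
  - rewrite -mulrA -/h -[leRHS]mule1; apply: lee_wpmul2l; first by rewrite lee_fin mulr_ge0.
    apply: probability_le1; apply: bigsetU_measurable => j _; exact: mpre.
  - by move=> j; exact: mpre.
  - apply/trivIsetP => i j _ _ ij; apply/seteqP; split=> // w [] /=.
    rewrite /Ik /= !in_itv/= => /andP[i1 i2] /andP[j1 j2].
    move: ij; rewrite neq_ltn => /orP[] lt.
      have : i.+1%:R * h <= j%:R * h by rewrite ler_wpM2r// ler_nat.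
      lra.
    have : j.+1%:R * h <= i%:R * h by rewrite ler_wpM2r// ler_nat.
    lra.
  - by apply: bigsetU_measurable => j _; exact: mpre.
apply/eqP; rewrite eq_le measure_ge0 andbT.
exact: (@le_inv_nat_eq0 _ _ (L * t)).
Qed.
End null_ties.

(** The third condition makes the number of requests before [t] finite, see
    [finite_requests]. *)
Definition good (R : realType) (n m : nat) (t : R) (g : 'I_n -> nat -> R)
    (k : 'I_n -> nat -> nat) : Prop :=
  [/\ forall i j, 0 < g i j,
      forall i j, (0 < k i j <= m)%N,
      forall i, exists j, t < g i j &
      forall r r', arr g r <= t -> arr g r' = arr g r -> r' = r].

Section good_realizations.
Context (R : realType) (m : nat) (F : probability nat R).
Hypothesis F_supp : F [set k | (1 <= k <= m)%N] = 1%:E.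
Context (lam : R) (lam0 : 0 < lam) (n : nat) (M : marked_poisson lam F n).
Context (t : R) (t0 : 0 <= t).
Let P := mp_prob M.

Let mgap i j : measurable_fun setT (gap M i j).
Proof. by []. Qed.

Let mgap_pre i j (B : set R) : measurable B -> measurable (gap M i j @^-1` B).
Proof. by move=> mB; rewrite -[X in measurable X]setTI; exact: mgap. Qed.

Lemma ae_gap_gt0 : {ae P, forall w, forall r : 'I_n * nat, 0 < gap M r.1 r.2 w}.
Proof.
apply: ae_forall_countable => -[i j].
apply: (@ae_not_null _ _ _ _ (gap M i j @^-1` `]-oo, 0])).
- exact: mgap_pre.
- by rewrite -(exponential_prob_itvNyc0 lam) -(gap_law M i j).
- by move=> w /negP; rewrite /= in_itv/= -leNgt.
Qed.

Lemma ae_mark_in_range :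
  {ae P, forall w, forall r : 'I_n * nat, (0 < mark M r.1 r.2 w <= m)%N}.
Proof.
apply: ae_forall_countable => -[i j].
apply: (@ae_not_null _ _ _ _ (mark M i j @^-1` ~` [set k | (1 <= k <= m)%N])) => //.
  by rewrite -[X in measurable X]setTI; apply: measurable_funP.
apply: (etrans (@mark_law _ _ _ _ M i j (~` [set k | (1 <= k <= m)%N]) _)) => //.
by rewrite probability_setC// F_supp subee.
Qed.

(** All gaps at [i] being at most [t] has probability at most [q ^+ k] for every
    [k], where [q < 1] is the probability for one gap. *)
Lemma ae_gap_large : {ae P, forall w, forall i, exists j, t < gap M i j w}.
Proof.
apply: ae_forall_countable => i.
have mN : measurable (\bigcap_j (gap M i j @^-1` `]-oo, t])).
  by apply: bigcapT_measurable => j; exact: mgap_pre.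
apply: (@ae_not_null _ _ _ _ (\bigcap_j (gap M i j @^-1` `]-oo, t]))) => //; last first.
  move=> w h j _ /=; rewrite in_itv/= leNgt; apply/negP => tj; apply: h.
  by exists j.
set N := \bigcap_j _ in mN *.
pose q := 1 - expR (- lam * t).
have q01 : 0 <= q < 1.
  have e0 : 0 < expR (- lam * t) by exact: expR_gt0.
  have e1 : expR (- lam * t) <= 1.
    by rewrite -expR0 ler_expR mulNr oppr_le0 mulr_ge0// ltW.
  by rewrite /q; lra.
have Nq k : (P N <= (q ^+ k)%:E)%E.
  pose J := [fset (i, val j) | j in 'I_k]%fset.
  apply: (@le_trans _ _ (P (\bigcap_(r in [set` J]) (gap M r.1 r.2 @^-1` `]-oo, t])))).
    apply: le_measure; rewrite ?inE//.
      by apply: fin_bigcap_measurable => // r _; exact: mgap_pre.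
    by move=> w Nw _ /imfsetP[j _ ->]; exact: Nw.
  rewrite prob_gaps_in// exponential_prob_itvNyc// big_imfset /=; last first.
    by move=> x y _ _ [/val_inj].
  by rewrite big_enum/= prodEFin prodr_const card_ord.
have fN : P N \is a fin_num by rewrite fin_num_measure.
suff PN0 : (P N <= 0)%E by apply/eqP; rewrite eq_le measure_ge0 andbT.
rewrite -(fineK fN) lee_fin.
have [q0 q1] := andP q01.
have cv : (fun k => q ^+ k) @ \oo --> (0 : R).
  by apply: cvg_expr; rewrite ger0_norm.
rewrite -(cvg_lim _ cv)//; apply: limr_ge; first by apply/cvg_ex; exists 0.
by apply: nearW => k; rewrite -lee_fin fineK.
Qed.

Let gap_events (r : 'I_n * nat) := generated_sigma_algebra (gap M r.1 r.2).

(** Simultaneity of two requests from different locations means that the first gap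
    [X] at one location equals a combination [Y] of other gaps, and these are
    independent of [X]. *)
Lemma ae_no_tie : {ae P, forall w, forall p : ('I_n * nat) * ('I_n * nat),
  p.1.1 != p.2.1 -> 0 < gap M p.1.1 0 w <= t ->
  arr (fun i j => gap M i j w) p.1 <> arr (fun i j => gap M i j w) p.2}.
Proof.
apply: ae_forall_countable => -[[i j] [i' j']] /=.
have [<-|ii'] := eqVneq i i'; first exact: aeW.
pose X := gap M i 0.
pose Y w := \sum_(l < j'.+1) gap M i' l w - \sum_(l < j) gap M i l.+1 w.
pose r0 := (i, 0%N).
pose S := cylinders (others gap_events r0).
have indep : mutually_independent P gap_events.
  apply: (mutually_independent_sub (h := inl)) (@gap_mark_independent _ _ _ _ M).
    by move=> r s [].
  by move=> r A.
have Gm r : gap_events r `<=` measurable.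
  by move=> _ [B mB <-]; rewrite setTI; exact: mgap_pre.
have GI r : setI_closed (gap_events r).
  by apply: preimage_set_system_setI => A B; exact: measurableI.
have mS r : r != r0 ->
    measurable_fun (setT : set (g_sigma_algebraType S)) (gap M r.1 r.2).
  move=> rr0 _ B mB; apply: sub_sigma_algebra; apply: (@cylinders1 _ _ _ r).
  by rewrite /others (negPf rr0); exists B.
have mSY : measurable_fun (setT : set (g_sigma_algebraType S)) Y.
  apply: measurable_funB; apply: measurable_sum => l.
    by apply: (mS (i', val l)); rewrite xpair_eqE eq_sym (negPf ii').
  by apply: (mS (i, l.+1)); rewrite xpair_eqE andbF.
have mY : measurable_fun setT Y.
  by apply: measurable_funB; apply: measurable_sum => l; exact: mgap.
have null : P [set w | X w = Y w /\ 0 < X w <= t + 1] = 0%E.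
  apply: (@null_coincidence _ _ _ _ _ _ lam) => //; first exact: ltW.
  - by rewrite ltr_wpDl.
  - move=> a b ab; apply: le_trans (exponential_prob_itvoc_le lam0 ab).
    by rewrite -(gap_law M i 0).
  - move=> a b; apply: (independent_of_others (i0 := r0) indep) => //.
      by exists `]a, b]%classic; rewrite ?setTI.
    by rewrite -[X in <<s _ >> X]setTI; apply: mSY.
apply: (ae_not_null _ null).
  rewrite (_ : [set w | _] = [set w | X w == Y w] `&` X @^-1` `]0, t + 1]%classic).
    apply: measurableI; last exact: mgap_pre.
    exact: (discretely_measurable_bool (measurable_fun_eqr (mgap i 0) mY) true).
  by apply/seteqP; split=> w /=; rewrite in_itv/= => -[/eqP].
move=> w /not_implyP[_ /not_implyP[/andP[X0 Xt] /contrapT tie]].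
split; last by rewrite X0 (le_trans Xt)// lerDl.
move: tie; rewrite /arr /= big_ord_recl /X /Y => <-.
by rewrite addrK.
Qed.

(** Requests of one location cannot be simultaneous because the gaps between them
    are positive; for two locations this is [ae_no_tie]. *)
Lemma ae_good : {ae P, forall w,
  good m t (fun i j => gap M i j w) (fun i j => mark M i j w)}.
Proof.
have pos_range : {ae P, forall w, (forall r : 'I_n * nat, 0 < gap M r.1 r.2 w) /\
    (forall r : 'I_n * nat, (0 < mark M r.1 r.2 w <= m)%N)}.
  by move: ae_gap_gt0 ae_mark_in_range; apply: filterS2.
move: pos_range ae_gap_large ae_no_tie; apply: filterS3 => w [pos range] large notie.
have pos' i j : 0 < gap M i j w by exact: (pos (i, j)).
pose g i j := gap M i j w.
have arr_lt i j j' : (j < j')%N -> arr g (i, j) < arr g (i, j').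
  apply: (@homo_ltn R (fun j => arr g (i, j)) (fun x y => x < y)) => [y x z|{}j].
    exact: lt_trans.
  by rewrite {2}/arr big_ord_recr/= ltrDl; exact: pos'.
split=> // [i j|[i j] [i' j'] le].
  exact: (range (i, j)).
have [->|ii'] := eqVneq i i'; last first.
  move=> /esym tie; case: (notie ((i, j), (i', j')) ii' _ tie).
  rewrite pos'/=; apply: le_trans le.
  by apply: gap_le_arr => // *; exact/ltW/pos'.
have [lt|lt|->//] := ltngtP j j' => e.
  by have := arr_lt i' _ _ lt; rewrite -e ltxx.
by have := arr_lt i' _ _ lt; rewrite e ltxx.
Qed.

End good_realizations.

(** * Comparison of the means *)

Section expectation_of_naturals.
Context d (T : measurableType d) (R : realType) (P : probability T R).

Definition bounded_count (X : T -> nat) : Prop :=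
  measurable_fun setT (fun w => (X w)%:R : R) /\ exists N, forall w, (X w <= N)%N.

Lemma expectation_count_ge0 (X : T -> nat) : (0 <= 'E_P[fun w => (X w)%:R])%E.
Proof. exact: expectation_ge0. Qed.

Lemma expectation_count_fin (X : T -> nat) : bounded_count X ->
  'E_P[fun w => (X w)%:R]%E \is a fin_num.
Proof.
move=> [mX [N XN]]; rewrite ge0_fin_numE ?expectation_count_ge0//.
apply: (@le_lt_trans _ _ ('E_P[cst N%:R])%E); last by rewrite expectation_cst ltry.
by apply: expectation_le => //; apply: aeW => w; rewrite ler_nat.
Qed.

Lemma expectation_countD (X Y Z : T -> nat) :
    bounded_count X -> bounded_count Y -> bounded_count Z ->
    {ae P, forall w, X w = (Y w + Z w)%N} ->
  fine 'E_P[fun w => (X w)%:R] =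
  fine 'E_P[fun w => (Y w)%:R] + fine 'E_P[fun w => (Z w)%:R].
Proof.
move=> bX bY bZ XYZ; rewrite -fineD ?expectation_count_fin//.
have [[[mX _] [mY _]] [mZ _]] := (bX, bY, bZ).
congr fine; rewrite unlock.
transitivity (\int[P]_w ((Y w)%:R%:E + (Z w)%:R%:E))%E.
  apply: ae_eq_integral => //.
  - exact/measurable_EFinP.
  - by apply: emeasurable_funD; exact/measurable_EFinP.
  - by move: XYZ; apply: filterS => w -> _; rewrite natrD EFinD.
by rewrite ge0_integralD//; exact/measurable_EFinP.
Qed.

Lemma expectation_count_le (X Y D : T -> nat) (C : R) :
    bounded_count X -> bounded_count Y ->
    measurable_fun setT (fun w => (D w)%:R : R) ->
    {ae P, forall w, (X w <= Y w + D w)%N} ->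
    ('E_P[fun w => (D w)%:R] <= C%:E)%E ->
  fine 'E_P[fun w => (X w)%:R] <= fine 'E_P[fun w => (Y w)%:R] + C.
Proof.
move=> bX bY mD XYD DC; have [[mX _] [mY _]] := (bX, bY).
rewrite -lee_fin EFinD !fineK ?expectation_count_fin//.
apply: (@le_trans _ _ ('E_P[fun w => (Y w)%:R] + 'E_P[fun w => (D w)%:R])%E); last first.
  exact: leeD2l.
apply: (@le_trans _ _ ('E_P[fun w => (Y w + D w)%N%:R : R])%E).
  apply: expectation_le => //; last by move: XYD; apply: filterS => w; rewrite ler_nat.
  by under eq_fun do rewrite natrD; exact: measurable_funD.
rewrite unlock -ge0_integralD//; try exact/measurable_EFinP.
rewrite le_eqVlt; apply/orP; left; apply/eqP/eq_integral => w _.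
by rewrite natrD EFinD.
Qed.

End expectation_of_naturals.

Section comparison.
Context (R : realType) (m : nat) (m_gt0 : (0 < m)%N) (F : probability nat R).
Hypothesis F_supp : F [set k | (1 <= k <= m)%N] = 1%:E.
Context (lam : R) (lam0 : 0 < lam) (t : R) (t0 : 0 <= t).

Let idle_prob : R := expR (- lam * t) ^+ m.

(** Each of the two sides of a cut contributes [m] times the expected number
    [idle_prob^-1] of blocks before the first idle one, plus one block. *)
Definition cut_cost : R := m%:R * (2 * idle_prob^-1 + 2).

Section one_realization.
Context (n : nat) (M : marked_poisson lam F n).
Let P := mp_prob M.

Let served request (w : mp_space M) :=
  #|serve_all request (orders t (fun i j => gap M i j w) (fun i j => mark M i j w))|.

Lemma mean_picked_upE request :
  mean_picked_up M request t = fine 'E_P[fun w => (served request w)%:R].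
Proof.
rewrite /mean_picked_up; congr (fine 'E_P[_]%E); apply/funext => w.
by rewrite picked_upE.
Qed.

Lemma served_bounded request : bounded_count R (served request).
Proof.
split; last by exists n => w; rewrite -[leqRHS]card_ord max_card.
by apply: measurable_card_serve => i j; [exact: measurable_funP|exact: measurable_funP].
Qed.

Lemma disjoint_slab (c c' : nat) : (c + m <= c')%N ->
  [disjoint slab n m c & slab n m c']%B.
Proof. by move=> cc'; apply/pred0P => x /=; rewrite !inE; lia. Qed.

Lemma card_slab_le c : (#|slab n m c| <= m)%N.
Proof. by apply: leq_trans (card_interval_le _ _ _) _; lia. Qed.

Lemma expected_run_right c K :
  ('E_P[fun w => (run_right m c K (idle t w))%:R] <= (idle_prob^-1)%:E)%E.
Proof.
rewrite unlock; apply: (@expected_idle_run _ _ lam0 _ _ M _ t0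
  (fun j => slab n m (c + j * m)) K _ m (fun j => card_slab_le _)).
move=> i j /andP[ij _]; apply: disjoint_slab.
by rewrite -addnA -mulSnr leq_add2l leq_mul2r ij orbT.
Qed.

Lemma expected_run_left c K : (K * m <= c)%N ->
  ('E_P[fun w => (run_left m c K (idle t w))%:R] <= (idle_prob^-1)%:E)%E.
Proof.
move=> Kc; rewrite unlock.
apply: (@expected_idle_run _ _ lam0 _ _ M _ t0
  (fun j => slab n m (c - j.+1 * m)) K _ m (fun j => card_slab_le _)).
move=> i j /andP[ij jK].
rewrite disjoint_sym; apply: disjoint_slab.
have jKm : (j.+1 * m <= K * m)%N by rewrite leq_mul2r jK orbT.
have ijm : (i.+1 * m <= j * m)%N by rewrite leq_mul2r ij orbT.
by move: jKm; rewrite mulSn => jKm; lia.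
Qed.

Lemma measurable_of_idle (f : {set 'I_n} -> nat) :
  measurable_fun setT (fun w : mp_space M => (f (idle t w))%:R : R).
Proof.
exact: (measurable_fun_discrete (fun Z => (f Z)%:R : R)
  (@discretely_measurable_idle _ _ _ _ M t)).
Qed.

Lemma expected_affected_zone (cl Kl cr Kr : nat) : (Kl * m <= cl)%N ->
  ('E_P[fun w => (m * ((run_left m cl Kl (idle t w)).+1 +
                       (run_right m cr Kr (idle t w)).+1))%N%:R] <= cut_cost%:E)%E.
Proof.
move=> Kcl; have l_le := expected_run_left Kcl; have r_le := expected_run_right cr Kr.
rewrite unlock in l_le r_le *.
pose l (w : mp_space M) : \bar R := (run_left m cl Kl (idle t w))%:R%:E.
pose r (w : mp_space M) : \bar R := (run_right m cr Kr (idle t w))%:R%:E.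
have ml : measurable_fun setT l by apply/measurable_EFinP; exact: measurable_of_idle.
have mr : measurable_fun setT r by apply/measurable_EFinP; exact: measurable_of_idle.
have -> : (\int[P]_w ((m * ((run_left m cl Kl (idle t w)).+1 +
    (run_right m cr Kr (idle t w)).+1))%N%:R%:E))%E =
    (\int[P]_w (m%:R%:E * (l w + r w + 2%:E)))%E.
  apply: eq_integral => w _; rewrite -!EFinD -EFinM; congr EFin.
  by rewrite natrM natrD -!natr1; ring.
rewrite ge0_integralZl//; last first.
- by move=> w _; rewrite !adde_ge0// lee_fin.
- by apply: emeasurable_funD => //; exact: emeasurable_funD.
rewrite /cut_cost EFinM; apply: lee_wpmul2l; first by rewrite lee_fin.
rewrite ge0_integralD//; last 2 first.
- by move=> w _; rewrite adde_ge0// lee_fin.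
- exact: emeasurable_funD.
rewrite ge0_integralD//; last 2 first.
- by move=> w _; rewrite lee_fin.
- by move=> w _; rewrite lee_fin.
rewrite integral_cst//= probability_setT mule1.
rewrite [leRHS]EFinD; apply: leeD => //.
by rewrite mulrDl mul1r EFinD; apply: leeD.
Qed.

Lemma good_orders (w : mp_space M) (g := fun i j => gap M i j w) (k := fun i j => mark M i j w) :
    good m t g k ->
  sizes_in_range m (orders t g k) /\
  (forall i b, (i, b) \in orders t g k -> i \notin idle t w).
Proof.
move=> [pos range _ _]; split=> i b; move/orders_active => /(_ (fun i j => ltW (pos i j))).
  by move=> [_ [j ->]]; exact: range.
by move=> [le _]; rewrite inE -leNgt.
Qed.

(** Only the a.s. case of good realizations matters for the means. *)
Lemma mean_picked_up_close request1 request2 (cl Kl cr Kr : nat) :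
    (Kl * m <= cl)%N ->
    (forall s (Z : {set 'I_n}), sizes_in_range m s ->
      (forall i k, (i, k) \in s -> i \notin Z) ->
      let d := (m * ((run_left m cl Kl Z).+1 + (run_right m cr Kr Z).+1))%N in
      let X := #|serve_all request1 s| in
      let Y := #|serve_all request2 s| in
      (X <= Y + d)%N /\ (Y <= X + d)%N) ->
  `|mean_picked_up M request1 t - mean_picked_up M request2 t| <= cut_cost.
Proof.
move=> Kcl close; rewrite !mean_picked_upE.
have mD := measurable_of_idle (fun Z =>
  (m * ((run_left m cl Kl Z).+1 + (run_right m cr Kr Z).+1))%N).
have DC := @expected_affected_zone cl Kl cr Kr Kcl.
have ae := ae_good F_supp lam0 M t0.
rewrite ler_distlC; apply/andP; split; last first.
  apply: (expectation_count_le _ _ mD _ DC); try exact: served_bounded.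
  by move: ae; apply: filterS => w /good_orders[sm sZ]; have [] := close _ _ sm sZ.
rewrite lerBlDr; apply: (expectation_count_le _ _ mD _ DC);
  try exact: served_bounded.
by move: ae; apply: filterS => w /good_orders[sm sZ]; have [] := close _ _ sm sZ.
Qed.

Lemma mean_circle_line_close : `|mean_circle M t - mean_line M t| <= cut_cost.
Proof.
apply: mean_picked_up_close (leq_trunc_div n m) _ => s Z.
exact: serve_circle_line.
Qed.

Lemma mean_cut_line_close c : (c <= n)%N ->
  `|mean_line M t - mean_picked_up M (cut_request c) t| <= cut_cost.
Proof.
move=> cn; apply: mean_picked_up_close (leq_trunc_div c m) _ => s Z.
exact: serve_line_cut.
Qed.

End one_realization.

(** Both halves are read off the same realization; in the absence of ties, the
    chronological order of the requests of a half is inherited from the whole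
    line. *)
Lemma mean_cut_line (a b : nat) (M : marked_poisson lam F (a + b)) :
  mean_picked_up M (cut_request a) t =
  mean_line (restrict (@lshift_inj a b) M) t +
  mean_line (restrict (@rshift_inj a b) M) t.
Proof.
rewrite /mean_line !mean_picked_upE; apply: expectation_countD.
- exact: served_bounded.
- exact: (served_bounded (restrict (@lshift_inj a b) M)).
- exact: (served_bounded (restrict (@rshift_inj a b) M)).
have := ae_good F_supp lam0 M t0; apply: filterS => w [pos _ large notie].
have fin := finite_requests (fun i j => ltW (pos i j)) large.
rewrite card_serve_cut; congr (_ + _)%N.
  by rewrite -(orders_pull (@lshift_inj a b) _ fin notie).
by rewrite -(orders_pull (@rshift_inj a b) _ fin notie).
Qed.

Lemma mean_line_almost_additive (line : forall n, marked_poisson lam F n) a b :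
  `|mean_line (line (a + b)%N) t - (mean_line (line a) t + mean_line (line b) t)|
    <= cut_cost.
Proof.
rewrite {2 3}/mean_line.
rewrite (mean_picked_up_unique (line a) (restrict (@lshift_inj a b) (line (a + b)%N))).
rewrite (mean_picked_up_unique (line b) (restrict (@rshift_inj a b) (line (a + b)%N))).
by rewrite -mean_cut_line; apply: mean_cut_line_close; exact: leq_addr.
Qed.

End comparison.

(** * Almost additive sequences, and the theorem *)

(** The value [u (k * n) / (k * n)] is within [c / n] of [u n / n] and within
    [c / k] of [u k / k]. So the quotients form a Cauchy sequence, and letting [k]
    tend to infinity gives the rate. *)
Lemma almost_additive_rate (R : realType) (u : nat -> R) (c : R) :
    (forall a b, `|u (a + b)%N - (u a + u b)| <= c) ->
  forall n, (0 < n)%N -> `|u n / n%:R - lim (u k / k%:R @[k --> \oo])| <= c / n%:R.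
Proof.
move=> uc.
have c0 : 0 <= c by exact: le_trans (uc 0%N 0%N).
have mult n k : (0 < n)%N -> (0 < k)%N ->
    `|u (k * n)%N / (k * n)%:R - u n / n%:R| <= c / n%:R.
  move=> n0 k0.
  have step j : `|u (j.+1 * n)%N - j.+1%:R * u n| <= j%:R * c.
    elim: j => [|j IH]; first by rewrite mul1n mul1r subrr normr0 mul0r.
    rewrite mulSn (_ : _ - _ = (u (n + j.+1 * n)%N - (u n + u (j.+1 * n)%N)) +
      (u (j.+1 * n)%N - j.+1%:R * u n)); last by rewrite -[in LHS]natr1; ring.
    apply: le_trans (ler_normD _ _) _.
    rewrite (_ : j.+1%:R * c = c + j%:R * c); last by rewrite -natr1; ring.
    exact: lerD.
  have nR : (0 < n%:R :> R) by rewrite ltr0n.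
  have kR : (0 < k%:R :> R) by rewrite ltr0n.
  rewrite (_ : _ - _ = (u (k * n)%N - k%:R * u n) / (k * n)%:R); last first.
    by rewrite natrM; field; rewrite !gt_eqF.
  rewrite normrM normfV [X in _ / X]ger0_norm// ler_pdivrMr; last first.
    by rewrite natrM mulr_gt0.
  case: k k0 kR => // k _ kR; apply: le_trans (step k) _.
  rewrite (_ : c / _ * _ = k.+1%:R * c); last by rewrite natrM; field; rewrite gt_eqF.
  by rewrite ler_wpM2r// ler_nat.
have pair n k : (0 < n)%N -> (0 < k)%N ->
    `|u n / n%:R - u k / k%:R| <= c / n%:R + c / k%:R.
  move=> n0 k0; have := mult k n k0 n0; rewrite mulnC => h.
  apply: le_trans (ler_distD (u (k * n)%N / (k * n)%:R) _ _) _.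
  by apply: lerD => //; rewrite distrC; exact: mult.
have le_inv n k : (0 < n)%N -> (n <= k)%N -> c / k%:R <= c / n%:R :> R.
  move=> n0 nk; rewrite ler_wpM2l// lef_pV2 ?posrE ?ltr0n ?ler_nat//.
  exact: leq_trans nk.
have cv : cvg (u k / k%:R @[k --> \oo]).
  apply/cauchy_cvgP/cauchy_exP => e e0 /=.
  pose N := (Num.truncn ((c + c) / e)).+1.
  exists (u N / N%:R); near=> k; rewrite /ball /=.
  have Nk : (N <= k)%N by near: k; exact: nbhs_infty_ge.
  have k0 : (0 < k)%N by exact: leq_trans Nk.
  apply: le_lt_trans (pair _ _ _ k0) _ => //.
  apply: (@le_lt_trans _ _ ((c + c) / N%:R)).
    by rewrite mulrDl lerD2l le_inv.
  by rewrite ltr_pdivrMr ?ltr0n// mulrC -ltr_pdivrMr// truncnS_gt.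
move=> n n0; rewrite -subr_le0 -lee_fin; apply: (@le_inv_nat_eq0 _ _ c) => N.
rewrite lee_fin lerBlDl.
have cvn : `|u n / n%:R - u k / k%:R| @[k --> \oo] -->
    `|u n / n%:R - lim (u k / k%:R @[k --> \oo])|.
  by apply: cvg_norm; apply: cvgB => //; exact: cvg_cst.
rewrite -(cvg_lim _ cvn)//; apply: limr_le; first by apply/cvg_ex; eexists; exact: cvn.
near=> k; have Nk : (N.+1 <= k)%N by near: k; exact: nbhs_infty_ge.
apply: le_trans (pair _ _ n0 (leq_trans _ Nk)) _ => //.
by rewrite lerD2l le_inv.
Unshelve. all: by end_near. Qed.

Theorem theorem3p4 (R : realType) (m : nat) (m_gt0 : (0 < m)%N)
    (F : probability nat R) (F_supp : F [set k | (1 <= k <= m)%N] = 1%:E)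
    (lam : R) (lam_gt0 : 0 < lam)
    (line circle : forall n, marked_poisson lam F n)
    (t : R) (t_ge0 : 0 <= t) :
  (fun n : nat => `|mean_circle (circle n) t / n%:R - alpha line t|)
    =O_\oo (fun n : nat => n%:R^-1 : R).
Proof.
pose c := cut_cost m lam t.
have additive := mean_line_almost_additive m_gt0 F_supp lam_gt0 t_ge0 line.
have c0 : 0 <= c by exact: le_trans (additive 0%N 0%N).
apply/eqO_exP; exists (c + c + 1); first by rewrite ltr_wpDl// addr_ge0.
near=> n; have n0 : (0 < n)%N by near: n; exact: nbhs_infty_gt.
have close : `|mean_circle (circle n) t - mean_line (line n) t| <= c.
  rewrite /mean_line (mean_picked_up_unique (line n) (circle n)).
  exact: mean_circle_line_close.
rewrite normr_id normfV normr_nat.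
apply: le_trans (ler_distD (mean_line (line n) t / n%:R) _ _) _.
apply: (@le_trans _ _ ((c + c) / n%:R)); last by rewrite ler_wpM2r// lerDl.
rewrite mulrDl; apply: lerD; last exact: almost_additive_rate additive _ n0.
by rewrite -mulrBl normrM normfV normr_nat ler_wpM2r.
Unshelve. all: by end_near. Qed.
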